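(* Let $g$ be an arithmetic function and let $f(n)=\sum_{d\mid n}g(d)$ for every $n\geqslant 1$. Suppose that $f(n),g(n)\ll_{\alpha}n^{\alpha}$ for some fixed $\alpha$ with $0<\alpha<1$. For $\operatorname{Re} z>1+\alpha$ let $L(z;f)=\sum_{n=1}^{+\infty}\frac{f(n)}{n^{z}}$. Then for every integer $k\geqslant 2$, $$L^{2}(2k-1;f)=\sum_{m=1}^{+\infty}\frac{g(m)}{m}\sum_{n=1}^{+\infty}\frac{f(n)}{n^{4k-3}}\,b_{k}\Bigl(\frac{n}{m}\Bigr).$$
   Context: An arithmetic function is a complex-valued function on the positive integers. The notation $h(n)\ll_{\alpha}n^{\alpha}$ means that there is a constant $C$ (depending on $\alpha$) with $|h(n)|\leqslant Cn^{\alpha}$ for all $n\geqslant 1$. $\psi(z)=\Gamma'(z)/\Gamma(z)$ is the digamma function. For integers $k\geqslant 1$ and $r\geqslant 0$ put $\varepsilon_{r}=\varepsilon_{r}(k)=\exp\bigl(\frac{2\pi i(r+1/2)}{2k}\bigr)$. For real $w>0$ define $b_{k}(w)=\frac{1}{k}\sum_{r=0}^{2k-1}\varepsilon_{r}^{2}\psi(\varepsilon_{r}w)$. *)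

(* Defs.v *)
From Stdlib Require Import Reals Factorial.
From Coquelicot Require Import Coquelicot.

Local Open Scope C_scope.

(* Limits and sums of complex sequences are taken componentwise; the value is
   arbitrary when the sequence or series does not converge. *)
Definition CLim_seq (u : nat -> C) : C :=
  (real (Lim_seq (fun n => Re (u n))), real (Lim_seq (fun n => Im (u n)))).

Definition CSeries (a : nat -> C) : C :=
  (Series (fun n => Re (a n)), Series (fun n => Im (a n))).

Definition ex_Cseries (a : nat -> C) : Prop :=
  @ex_series C_AbsRing C_NormedModule a.

Lemma CSeries_correct (a : nat -> C) :
  ex_Cseries a -> @is_series C_AbsRing C_NormedModule a (CSeries a).
Proof.
intros [l Hl].
assert (Hs : forall n, sum_n a n =
          (sum_n (fun i => Re (a i)) n, sum_n (fun i => Im (a i)) n)).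
{ intro n; induction n as [|n IH].
  - rewrite !sum_O; unfold Re, Im; now destruct (a 0%nat).
  - rewrite !sum_Sn, IH; unfold Re, Im; now destruct (a (S n)). }
assert (H1 : is_series (fun n => Re (a n)) (fst l)).
{ unfold is_series.
  eapply filterlim_ext; [ | exact (filterlim_comp _ _ _ _ _ _ _ _ Hl (continuous_fst (U := R_UniformSpace) (V := R_UniformSpace) (fst l) (snd l)))].
  intro n; cbv beta; now rewrite Hs. }
assert (H2 : is_series (fun n => Im (a n)) (snd l)).
{ unfold is_series.
  eapply filterlim_ext; [ | exact (filterlim_comp _ _ _ _ _ _ _ _ Hl (continuous_snd (U := R_UniformSpace) (V := R_UniformSpace) (fst l) (snd l)))].
  intro n; cbv beta; now rewrite Hs. }
unfold CSeries; rewrite (is_series_unique _ _ H1), (is_series_unique _ _ H2).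
now rewrite <- surjective_pairing.
Qed.

Definition Cexp (z : C) : C :=
  RtoC (exp (Re z)) * (cos (Im z), sin (Im z)).

(* n ^ z = exp (z log n), for n >= 1. *)
Definition nat_Cpow (n : nat) (z : C) : C := Cexp (z * RtoC (ln (INR n))).

Fixpoint rising (z : C) (n : nat) : C :=
  match n with
  | O => RtoC 1
  | S n' => rising z n' * (z + RtoC (INR n'))
  end.

(* Gauss's formula, valid at every z other than 0, -1, -2, ...:
   Gamma z = lim  n! n^z / (z (z + 1) ... (z + n)). *)
Definition CGamma (z : C) : C :=
  CLim_seq (fun n => RtoC (INR (fact n)) * nat_Cpow n z / rising z (S n)).

(* The complex derivative; C_derive agrees with it wherever CGamma is complex
   differentiable, i.e. away from the poles 0, -1, -2, ... *)
Definition digamma (z : C) : C := C_derive CGamma z / CGamma z.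

Definition eps (k r : nat) : C :=
  Cexp (RtoC 2 * RtoC PI * Ci * (RtoC (INR r) + / RtoC 2)
        / (RtoC 2 * RtoC (INR k))).

(* For w > 0 the points eps k r * w are never real, so they avoid the poles of
   the digamma function. *)
Definition b (k : nat) (w : R) : C :=
  / RtoC (INR k) *
  sum_n (fun r => eps k r ^ 2 * digamma (eps k r * RtoC w)) (2 * k - 1).

(* An arithmetic function is given by its values at the integers n >= 1; the
   value at 0 is never used. *)
Definition divisor_sum (g : nat -> C) (n : nat) : C :=
  sum_n_m (fun d => if (n mod d =? 0)%nat then g d else RtoC 0) 1 n.

Definition poly_bounded (h : nat -> C) (alpha : R) : Prop :=
  exists K : R, forall n : nat, (1 <= n)%nat ->
    (Cmod (h n) <= K * Rpower (INR n) alpha)%R.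

Definition dirichlet_term (f : nat -> C) (z : C) (n : nat) : C :=
  f n / nat_Cpow n z.

(* Series over n >= 1 are indexed from 0, with n = S i. *)
Definition L (f : nat -> C) (z : C) : C :=
  CSeries (fun i => dirichlet_term f z (S i)).

Definition inner_term (f : nat -> C) (k m n : nat) : C :=
  f n / RtoC (INR n) ^ (4 * k - 3) * b k (INR n / INR m).

Definition outer_term (f g : nat -> C) (k m : nat) : C :=
  g m / RtoC (INR m) * CSeries (fun i => inner_term f k m (S i)).

(* Main.v *)
Require Import Defs.
From Stdlib Require Import Reals Lra Lia Factorial Ranalysis5.
From Coquelicot Require Import Coquelicot.

(** Everything rests on the identity, valid for [k >= 2] and [w > 0],
    << b_k(w) = 2 w^(2k-2) sum_(j >= 1) j / (j^(2k) + w^(2k)). >>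
    It follows from [psi(z) = lim (ln n - sum_(j <= n) 1 / (z + j))]: the squares
    of the roots [eps] of [X^(2k) = -1] sum to zero, which removes [ln n], and
    expanding [eps^2 / (eps w + j)] in powers of [eps] leaves only the terms in
    [eps^(2k) = -1] ([eps_partial_fractions], [b_series]).

    With [w = n / m] and [N = j m] the right-hand side of the theorem becomes the
    triple series, with [s = 2 k - 1],
    << sum_m sum_n sum_(N, m | N) g(m) f(n) n^(-s) 2 N / (N^(2k) + n^(2k)). >>
    Summing over [m] first replaces [g] by [f(N) = sum_(m | N) g(m)]. What is left
    is a double series over [n] and [N]; averaged with its transpose, its general
    term becomes [f(n) f(N) / (n N)^s], and the sum is the square of the Dirichlet
    series ([symmetric_double_series]).

    All rearrangements are justified by one bound. Since [m <= N] and [s >= 3], the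
    triple series is dominated by a constant times [(m n N)^(-p)] with
    [p = (3 - alpha) / 2 > 1] ([divisor_power_bound]), and the interchange of two
    summations under a product bound is elementary ([series_fubini]).

    The formula for [psi] has to be derived from Gauss's limit for the Gamma
    function. Off the real axis the n-th Gauss quotient is the exponential of an
    explicit sum of logarithms. On a horizontal line these exponents and their
    derivatives have increments of order [1 / n^2], locally uniformly, so one may
    differentiate in the limit ([telescoping_is_derive], [digamma_lim]). *)

(** * Elementary estimates and convergence *)

Lemma ln_le_sub1 (x : R) : 0 < x -> ln x <= x - 1.
Proof.
intro Hx; pose proof (exp_ineq1_le (ln x)) as H.
rewrite exp_ln in H; lra.
Qed.

Lemma ln_ge_1_sub_inv (x : R) : 0 < x -> 1 - / x <= ln x.
Proof.
intro Hx; pose proof (ln_le_sub1 (/ x) (Rinv_0_lt_compat _ Hx)) as H.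
rewrite ln_Rinv in H; lra.
Qed.

Lemma ln_1_add_approx (v : R) : Rabs v <= / 2 -> Rabs (ln (1 + v) - v) <= 2 * v ^ 2.
Proof.
intro Hv; apply Rabs_le_between in Hv.
pose proof (ln_le_sub1 (1 + v) ltac:(lra)) as H1.
pose proof (ln_ge_1_sub_inv (1 + v) ltac:(lra)) as H2.
assert (H3 : v - 2 * v ^ 2 <= 1 - / (1 + v)).
{ assert (0 <= (1 - / (1 + v) - (v - 2 * v ^ 2)) ) ; [|lra].
  replace (1 - / (1 + v) - (v - 2 * v ^ 2))
    with (v ^ 2 * (1 + 2 * v) * / (1 + v)) by (field; lra).
  assert (0 < / (1 + v)) by (apply Rinv_0_lt_compat; lra).
  apply Rmult_le_pos; [apply Rmult_le_pos|]; nra. }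
apply Rabs_le; nra.
Qed.

Lemma atan_approx (v : R) : Rabs (atan v - v) <= v ^ 2.
Proof.
destruct (MVT_gen atan 0 v (fun c => / (1 + c ^ 2))) as [c [Hc E]].
- intros x _; evar_last; [apply is_derive_atan|].
  unfold Rsqr; f_equal; ring.
- intros x _; apply derivable_continuous_pt, derivable_pt_atan.
- rewrite atan_0 in E.
  replace (atan v - v) with (- (v * (c ^ 2 * / (1 + c ^ 2)))).
  2:{ replace (atan v) with (atan v - 0) by ring; rewrite E; field; nra. }
  rewrite Rabs_Ropp, Rabs_mult, <- (pow2_abs v).
  replace (Rabs v ^ 2) with (Rabs v * Rabs v) by ring.
  apply Rmult_le_compat_l; [apply Rabs_pos|].
  assert (Hcv : Rabs c <= Rabs v).
  { revert Hc; unfold Rmin, Rmax, Rabs.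
    destruct (Rle_dec 0 v), (Rcase_abs c), (Rcase_abs v); intros; lra. }
  pose proof (Rabs_pos c).
  assert (Hc2 : c ^ 2 = Rabs c ^ 2) by now rewrite pow2_abs.
  rewrite Hc2, Rabs_pos_eq.
  + apply (Rmult_le_reg_r (1 + Rabs c ^ 2)); [nra|].
    rewrite Rmult_assoc, Rinv_l by nra; nra.
  + apply Rmult_le_pos; [nra|].
    left; apply Rinv_0_lt_compat; nra.
Qed.

Lemma ln_succ_approx (n : nat) : (1 <= n)%nat ->
  Rabs (ln (INR (S n)) - ln (INR n) - / INR (S n)) <= / (INR n * INR (S n)).
Proof.
intro Hn; assert (0 < INR n) by (apply lt_0_INR; lia).
assert (Hq : 0 < INR (S n) / INR n)
  by (apply Rdiv_lt_0_compat; [apply lt_0_INR; lia | easy]).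
rewrite <- ln_div by (try apply lt_0_INR; lia || easy).
pose proof (ln_le_sub1 _ Hq) as H1; pose proof (ln_ge_1_sub_inv _ Hq) as H2.
rewrite S_INR in *.
replace ((INR n + 1) / INR n - 1)
  with (/ (INR n + 1) + / (INR n * (INR n + 1))) in H1 by (field; lra).
replace (1 - / ((INR n + 1) / INR n)) with (/ (INR n + 1)) in H2 by (field; lra).
apply Rabs_le; split; lra.
Qed.

(** The bound is the telescoping difference [c / n - c / (n + 1)], so the limit
    comes with the explicit error [c / n]. When [s] depends on a parameter and
    [c], [N] do not, that error is what makes the convergence uniform. *)
Lemma seq_cv_rate (s : nat -> R) (c : R) (N : nat) :
  (1 <= N)%nat -> 0 <= c ->
  (forall n, (N <= n)%nat ->
     Rabs (s (S n) - s n) <= c / (INR n * INR (S n))) ->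
  exists l : R, is_lim_seq s l /\
    forall n, (N <= n)%nat -> Rabs (l - s n) <= c / INR n.
Proof.
intros HN Hc H.
assert (Hpos : forall n, (N <= n)%nat -> 0 < INR n)
  by (intros n Hn; apply lt_0_INR; lia).
assert (Hdist : forall n d, (N <= n)%nat ->
          Rabs (s (d + n)%nat - s n) <= c / INR n - c / INR (d + n)).
{ intros n d Hn; induction d as [|d IH].
  - simpl; rewrite Rminus_diag, Rabs_R0; lra.
  - replace (s (S d + n)%nat - s n)
      with ((s (S (d + n)) - s (d + n)%nat) + (s (d + n)%nat - s n))
      by (simpl; ring).
    eapply Rle_trans; [apply Rabs_triang|].
    pose proof (H (d + n)%nat ltac:(lia)) as H1.
    pose proof (Hpos (d + n)%nat ltac:(lia)).
    replace (c / (INR (d + n) * INR (S (d + n))))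
      with (c / INR (d + n) - c / INR (S d + n)) in H1; [lra|].
    change (S d + n)%nat with (S (d + n)); rewrite S_INR; field; lra. }
assert (Hle : forall n m, (N <= n)%nat -> (n <= m)%nat ->
          Rabs (s m - s n) <= c / INR n).
{ intros n m Hn Hm; replace m with ((m - n) + n)%nat by lia.
  eapply Rle_trans; [now apply Hdist|].
  pose proof (Hpos (m - n + n)%nat ltac:(lia)) as Hp.
  apply Rinv_0_lt_compat in Hp; unfold Rdiv; nra. }
assert (Hcau : ex_lim_seq_cauchy s).
{ intro eps.
  destruct (nfloor_ex (Rmax 0 (2 * c / eps)) (Rmax_l _ _)) as [K [_ HK]].
  set (n0 := (N + S K)%nat).
  assert (Hn0 : 2 * (c / INR n0) < eps).
  { assert (Hn0 : 2 * c / eps < INR n0).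
    { apply (Rle_lt_trans _ _ _ (Rmax_r 0 _)), (Rlt_le_trans _ _ _ HK).
      rewrite <- S_INR; apply le_INR; unfold n0; lia. }
    pose proof (cond_pos eps).
    assert (0 < INR n0) by (apply lt_0_INR; unfold n0; lia).
    apply (Rmult_lt_compat_r eps) in Hn0; [|easy].
    replace (2 * c / eps * eps) with (2 * c) in Hn0 by (field; lra).
    apply (Rmult_lt_reg_r (INR n0)); [easy|].
    replace (2 * (c / INR n0) * INR n0) with (2 * c) by (field; lra); lra. }
  exists n0; intros n m Hn Hm.
  pose proof (Hle n0 n ltac:(unfold n0; lia) Hn) as H1.
  pose proof (Hle n0 m ltac:(unfold n0; lia) Hm) as H2.
  apply Rabs_le_between in H1; apply Rabs_le_between in H2.
  apply Rabs_lt_between; lra. }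
apply ex_lim_seq_cauchy_corr in Hcau; destruct Hcau as [l Hl].
exists l; split; [exact Hl|]; intros n Hn.
assert (Hl' : is_lim_seq (fun m => Rabs (s m - s n)) (Rabs (l - s n))).
{ apply (is_lim_seq_abs _ (Finite (l - s n))).
  apply is_lim_seq_minus'; [exact Hl | apply is_lim_seq_const]. }
refine (is_lim_seq_le_loc _ (fun _ => c / INR n) (Finite _) (Finite _) _ Hl'
          (is_lim_seq_const _)).
exists n; intros m Hm; now apply Hle.
Qed.

(** Comparison with the telescoping series of [n^(1-p) - (n+1)^(1-p)]: convexity
    of the exponential bounds each difference below by [(p - 1) (n+1)^(-p)]. *)
Lemma ex_series_Rpower (p : R) : 1 < p ->
  ex_series (fun i => Rpower (INR (S i)) (- p)).
Proof.
intro Hp.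
set (t := fun n => Rpower (INR (S n)) (1 - p)).
assert (Ht : forall n, (p - 1) * Rpower (INR (S (S n))) (- p) <= t n - t (S n)).
{ intro n; unfold t.
  assert (H0 : 0 < INR (S n)) by (apply lt_0_INR; lia).
  assert (H1 : 0 < INR (S (S n))) by (apply lt_0_INR; lia).
  replace (- p) with ((1 - p) + - (1)) by ring.
  rewrite Rpower_plus, Rpower_Ropp, Rpower_1 by easy.
  set (y := INR (S (S n))) in *; set (x := INR (S n)) in *.
  assert (E : Rpower x (1 - p) = Rpower y (1 - p) * exp ((p - 1) * ln (y / x))).
  { unfold Rpower; rewrite <- exp_plus, ln_div by easy; f_equal; ring. }
  rewrite E.
  pose proof (exp_ineq1_le ((p - 1) * ln (y / x))) as He.
  pose proof (ln_ge_1_sub_inv (y / x) ltac:(now apply Rdiv_lt_0_compat)) as Hl.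
  replace (1 - / (y / x)) with (/ y) in Hl.
  2:{ unfold y, x; rewrite (S_INR (S n)); fold x; field; lra. }
  assert (Hy : 0 < Rpower y (1 - p)) by apply exp_pos.
  apply (Rmult_le_compat_l (p - 1)) in Hl; [|lra].
  assert (0 <= Rpower y (1 - p) * (exp ((p - 1) * ln (y / x)) - 1 - (p - 1) * / y)); [|lra].
  apply Rmult_le_pos; lra. }
apply ex_series_incr_1.
assert (Htel : forall n, sum_n (fun i => t i - t (S i)) n = t 0%nat - t (S n)).
{ induction n as [|n IH]; [now rewrite sum_O|].
  rewrite sum_Sn, IH; unfold plus; simpl; ring. }
assert (Hdec : ex_series (fun i => t i - t (S i))).
{ destruct (ex_finite_lim_seq_decr (fun n => t (S n)) 0) as [l Hl].
  - intro n; pose proof (Ht (S n)).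
    assert (0 < Rpower (INR (S (S (S n)))) (- p)) by apply exp_pos; nra.
  - intro n; left; apply exp_pos.
  - exists (t 0%nat - l).
    change (is_lim_seq (sum_n (fun i => t i - t (S i))) (Finite (t 0%nat - l))).
    apply (is_lim_seq_ext (fun n => t 0%nat - t (S n))).
    + intro n; now rewrite Htel.
    + apply is_lim_seq_minus'; [apply is_lim_seq_const | exact Hl]. }
apply (ex_series_le (K := R_AbsRing) (V := R_CompleteNormedModule) _
         (fun i => (t i - t (S i)) * / (p - 1))).
- intro n.
  assert (0 < Rpower (INR (S (S n))) (- p)) by apply exp_pos.
  change (Rabs (Rpower (INR (S (S n))) (- p)) <= (t n - t (S n)) * / (p - 1)).
  rewrite Rabs_pos_eq by lra.
  apply (Rmult_le_reg_r (p - 1)); [lra|].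
  rewrite Rmult_assoc, Rinv_l, Rmult_1_r by lra.
  pose proof (Ht n); lra.
- now apply ex_series_scal_r.
Qed.

(** * Interchange of summations *)

Lemma sum_n_norm_le {K : AbsRing} {V : NormedModule K} (a : nat -> V)
  (b : nat -> R) (n : nat) :
  (forall i, norm (a i) <= b i) -> norm (sum_n a n) <= sum_n b n.
Proof.
intros H; eapply Rle_trans; [apply norm_sum_n_m | now apply sum_n_m_le].
Qed.

Lemma series_norm_le {K : AbsRing} {V : NormedModule K} (a : nat -> V)
  (b : nat -> R) (l : V) (B : R) :
  (forall i, norm (a i) <= b i) -> is_series a l -> is_series b B ->
  norm l <= B.
Proof.
intros H Ha Hb.
apply (is_lim_seq_le (fun n => norm (sum_n a n)) (sum_n b)
         (Finite (norm l)) (Finite B)).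
- now intro n; apply sum_n_norm_le.
- exact (filterlim_comp _ _ _ _ _ _ _ _ Ha (filterlim_norm l)).
- exact Hb.
Qed.

Lemma is_series_finite_sum {K : AbsRing} {V : NormedModule K}
  (a : nat -> nat -> V) (c : nat -> V) (n : nat) :
  (forall j, is_series (fun i => a i j) (c j)) ->
  is_series (fun i => sum_n (a i) n) (sum_n c n).
Proof.
intros H; induction n as [|n IH].
- rewrite sum_O; eapply is_series_ext; [|apply H].
  intro i; now rewrite sum_O.
- rewrite sum_Sn; eapply is_series_ext; [|apply (is_series_plus _ _ _ _ IH (H (S n)))].
  intro i; now rewrite sum_Sn.
Qed.

Lemma plus_minus_cancel {G : AbelianGroup} (x y : G) : plus (minus x y) y = x.
Proof.
unfold minus; now rewrite <- plus_assoc, plus_opp_l, plus_zero_r.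
Qed.

Lemma series_tail_norm_le {K : AbsRing} {V : NormedModule K} (a : nat -> V)
  (b : nat -> R) (l : V) (B : R) (n : nat) :
  (forall i, norm (a i) <= b i) -> is_series a l -> is_series b B ->
  norm (minus l (sum_n a n)) <= B - sum_n b n.
Proof.
intros H Ha Hb.
apply (series_norm_le (fun i => a (S n + i)%nat) (fun i => b (S n + i)%nat)).
- intro i; apply H.
- apply is_series_incr_n; [lia|]; cbn [Init.Nat.pred].
  rewrite <- (plus_minus_cancel l (sum_n a n)) in Ha; exact Ha.
- apply is_series_incr_n; [lia|]; cbn [Init.Nat.pred].
  replace B with ((B - sum_n b n) + sum_n b n) in Hb by ring; exact Hb.
Qed.

(** The product bound makes the interchange elementary: the error
    [T - sum_(j <= n) c j] is the sum over the rows of their tails, hence at most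
    [(sum u) * (tail of sum v)]. *)
Lemma series_fubini {K : AbsRing} {V : CompleteNormedModule K}
  (a : nat -> nat -> V) (r c : nat -> V) (u v : nat -> R) :
  ex_series u -> ex_series v ->
  (forall i, 0 <= u i) ->
  (forall i j, norm (a i j) <= u i * v j) ->
  (forall i, is_series (a i) (r i)) ->
  (forall j, is_series (fun i => a i j) (c j)) ->
  exists T, is_series r T /\ is_series c T.
Proof.
intros [U HU] [W HW] u0 Ha Hr Hc.
assert (Hrow : forall i, is_series (fun j => u i * v j) (u i * W)).
{ intro i; exact (is_series_scal_l (u i) v W HW). }
assert (HUx : forall x : R, is_series (fun i => u i * x) (U * x)).
{ intro x; generalize (is_series_scal_r x u U HU); intro H0; exact H0. }
assert (Hex : ex_series r).
{ apply (ex_series_le r (fun i => u i * W)).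
  - intro i; exact (series_norm_le _ _ _ _ (Ha i) (Hr i) (Hrow i)).
  - exists (U * W); apply HUx. }
destruct Hex as [T HT]; exists T; split; [exact HT|].
unfold is_series; apply filterlim_locally_ball_norm; intro eps.
assert (HU0 : 0 <= U).
{ apply (is_lim_seq_le (fun _ => 0) (sum_n u) (Finite 0) (Finite U)).
  - intro n; apply (Rle_trans _ (sum_n (fun _ => 0) n)).
    + rewrite sum_n_const; lra.
    + now apply sum_n_m_le.
  - apply is_lim_seq_const.
  - exact HU. }
assert (Hbound : forall n, norm (minus T (sum_n c n)) <= U * (W - sum_n v n)).
{ intro n.
  refine (series_norm_le _ _ _ _ _
            (is_series_minus _ _ _ _ HT (is_series_finite_sum _ _ n Hc))
            (HUx (W - sum_n v n))).
  intro i; cbv beta.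
  eapply Rle_trans; [exact (series_tail_norm_le _ _ _ _ n (Ha i) (Hr i) (Hrow i))|].
  replace (sum_n (fun j => u i * v j) n) with (u i * sum_n v n); [lra|].
  symmetry; exact (sum_n_mult_l (K := R_Ring) (u i) v n). }
assert (He : 0 < eps / (U + 1)) by (apply Rdiv_lt_0_compat; [apply cond_pos | lra]).
destruct (proj2 (is_lim_seq_spec (sum_n v) W) HW (mkposreal _ He)) as [N HN].
exists N; intros n Hn.
unfold ball_norm.
rewrite <- norm_opp, opp_minus.
apply (Rle_lt_trans _ _ _ (Hbound n)).
specialize (HN n Hn); simpl in HN.
apply Rabs_lt_between in HN.
apply (Rle_lt_trans _ (U * (eps / (U + 1)))).
- apply Rmult_le_compat_l; [exact HU0 | lra].
- pose proof (cond_pos eps).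
  replace (U * (eps / (U + 1))) with (eps - eps / (U + 1)) by (field; lra).
  simpl in *; lra.
Qed.

(** * Gauss's product and the digamma function *)

(** [log_re y x] and [log_im y x] are the real and imaginary parts of the
    principal logarithm of [x + i y] for [y <> 0]. The formula with [x / y] is
    smooth on the whole horizontal line, unlike [atan (y / x)], which breaks at
    [x = 0]. *)
Definition log_re (y x : R) : R := / 2 * ln (x ^ 2 + y ^ 2).

Definition log_im (y x : R) : R :=
  (if Rlt_dec 0 y then PI / 2 else - (PI / 2)) - atan (x / y).

Lemma Cexp_plus (z w : C) : Cexp (z + w) = (Cexp z * Cexp w)%C.
Proof.
destruct z as [a b], w as [c d]; unfold Cexp, Re, Im, RtoC, Cmult; simpl.
rewrite exp_plus, cos_plus, sin_plus; apply injective_projections; simpl; ring.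
Qed.

Lemma Cexp_0 : Cexp 0 = 1.
Proof.
unfold Cexp, Re, Im; simpl; rewrite exp_0, cos_0, sin_0.
apply injective_projections; simpl; ring.
Qed.

Lemma Cexp_opp_mult (z : C) : (Cexp (- z) * Cexp z)%C = 1.
Proof.
rewrite <- Cexp_plus, <- Cexp_0; f_equal; ring.
Qed.

Lemma Cexp_nz (z : C) : Cexp z <> 0.
Proof.
intro H; pose proof (Cexp_opp_mult z) as E; rewrite H, Cmult_0_r in E.
apply C1_nz; now symmetry.
Qed.

Lemma Cexp_opp (z : C) : Cexp (- z) = (/ Cexp z)%C.
Proof.
rewrite <- (Cmult_1_r (Cexp (- z))), <- (Cinv_r (Cexp z)) by apply Cexp_nz.
rewrite Cmult_assoc, Cexp_opp_mult; ring.
Qed.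

Lemma Cexp_log (x y : R) : y <> 0 -> Cexp (log_re y x, log_im y x) = (x, y).
Proof.
intro Hy.
assert (Hy2 : 0 < y ^ 2) by nra.
assert (Hs : exp (log_re y x) = Rabs y * sqrt (1 + (x / y)²)).
{ unfold log_re.
  rewrite <- sqrt_Rsqr_abs, <- sqrt_mult by (unfold Rsqr; nra).
  replace (y² * (1 + (x / y)²)) with (x ^ 2 + y ^ 2)
    by (unfold Rsqr; field; easy).
  rewrite <- Rpower_sqrt by nra; unfold Rpower; reflexivity. }
assert (Hq : 0 < sqrt (1 + (x / y)²)).
{ apply sqrt_lt_R0; pose proof (Rle_0_sqr (x / y)); lra. }
unfold Cexp, Re, Im, RtoC, Cmult; cbn [fst snd].
rewrite Hs; unfold log_im.
assert (Hsc : cos (PI / 2) = 0 /\ sin (PI / 2) = 1)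
  by (split; [apply cos_PI2 | apply sin_PI2]).
destruct Hsc as [Hc0 Hs1].
destruct (Rlt_dec 0 y) as [Hp|Hn].
- rewrite cos_minus, sin_minus, Hc0, Hs1, sin_atan, cos_atan, Rabs_pos_eq by lra.
  apply injective_projections; cbn [fst snd]; field; lra.
- rewrite cos_minus, sin_minus, cos_neg, sin_neg, Hc0, Hs1, sin_atan, cos_atan.
  rewrite Rabs_left by lra.
  apply injective_projections; cbn [fst snd]; field; lra.
Qed.

Lemma is_derive_log_re (y x : R) : y <> 0 ->
  is_derive (log_re y) x (x / (x ^ 2 + y ^ 2)).
Proof.
intro Hy; assert (0 < x ^ 2 + y ^ 2) by nra.
unfold log_re; auto_derive; [lra | simpl in *; field; lra].
Qed.

Lemma is_derive_log_im (y x : R) : y <> 0 ->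
  is_derive (log_im y) x (- y / (x ^ 2 + y ^ 2)).
Proof.
intro Hy; assert (0 < x ^ 2 + y ^ 2) by nra.
unfold log_im; auto_derive; [easy | simpl in *; field; repeat split; nra].
Qed.

Lemma log_im_pos (y x : R) : 0 < x -> y <> 0 -> log_im y x = atan (y / x).
Proof.
intros Hx Hy; unfold log_im; destruct (Rlt_dec 0 y) as [Hp|Hn].
- rewrite <- atan_inv by (apply Rdiv_lt_0_compat; lra).
  f_equal; field; lra.
- replace (x / y) with (- (x / - y)) by (field; lra).
  rewrite atan_opp; replace (y / x) with (- / (x / - y)) by (field; lra).
  rewrite atan_opp, atan_inv by (apply Rdiv_lt_0_compat; lra); ring.
Qed.

(** For [y <> 0], [gauss_re] and [gauss_im] are the components of a logarithm of
    the n-th quotient in Gauss's formula at [z = x + i y], namely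
    [ln n! + z ln n - sum_(j <= n) log (z + j)]. The functions [dgauss_re] and
    [dgauss_im] are the components of its derivative
    [ln n - sum_(j <= n) 1 / (z + j)]. *)
Definition gauss_re (y : R) (n : nat) (x : R) : R :=
  ln (INR (fact n)) + x * ln (INR n) - sum_n (fun j => log_re y (x + INR j)) n.

Definition gauss_im (y : R) (n : nat) (x : R) : R :=
  y * ln (INR n) - sum_n (fun j => log_im y (x + INR j)) n.

Definition dgauss_re (y : R) (n : nat) (x : R) : R :=
  ln (INR n) - sum_n (fun j => (x + INR j) / ((x + INR j) ^ 2 + y ^ 2)) n.

Definition dgauss_im (y : R) (n : nat) (x : R) : R :=
  - sum_n (fun j => - y / ((x + INR j) ^ 2 + y ^ 2)) n.

Lemma rising_exp (x y : R) (n : nat) : y <> 0 ->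
  rising (x, y) (S n) =
  Cexp (sum_n (fun j => log_re y (x + INR j)) n,
        sum_n (fun j => log_im y (x + INR j)) n).
Proof.
intro Hy; induction n as [|n IH].
- rewrite !sum_O, Cexp_log by easy.
  simpl; apply injective_projections; simpl; ring.
- change (rising (x, y) (S (S n)))
    with (rising (x, y) (S n) * ((x, y) + RtoC (INR (S n))))%C.
  rewrite IH, !sum_Sn.
  replace ((x, y) + RtoC (INR (S n)))%C
    with (Cexp (log_re y (x + INR (S n)), log_im y (x + INR (S n)))).
  + rewrite <- Cexp_plus; f_equal.
  + rewrite Cexp_log by easy.
    apply injective_projections; simpl; ring.
Qed.

Lemma gauss_exp (x y : R) (n : nat) : y <> 0 ->
  (RtoC (INR (fact n)) * nat_Cpow n (x, y) / rising (x, y) (S n))%C =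
  Cexp (gauss_re y n x, gauss_im y n x).
Proof.
intro Hy; rewrite rising_exp by easy.
assert (Hf : RtoC (INR (fact n)) = Cexp (RtoC (ln (INR (fact n))))).
{ unfold Cexp, Re, Im; simpl.
  rewrite exp_ln by apply INR_fact_lt_0.
  rewrite cos_0, sin_0; apply injective_projections; simpl; ring. }
rewrite Hf; unfold nat_Cpow, Cdiv.
rewrite <- Cexp_opp, <- !Cexp_plus; f_equal.
unfold gauss_re, gauss_im; apply injective_projections; simpl; ring.
Qed.

Lemma is_derive_shift (F : R -> R) (a x l : R) :
  is_derive F (x + a) l -> is_derive (fun t => F (t + a)) x l.
Proof.
intro H; evar_last.
- apply (is_derive_comp F (fun t => t + a) x l 1); [exact H|].
  auto_derive; [easy | ring].
- unfold scal; simpl; unfold mult; simpl; ring.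
Qed.

Lemma is_derive_gauss_re (y x : R) (n : nat) : y <> 0 ->
  is_derive (gauss_re y n) x (dgauss_re y n x).
Proof.
intro Hy; unfold gauss_re, dgauss_re.
apply (is_derive_minus (fun x => ln (INR (fact n)) + x * ln (INR n))).
- auto_derive; [easy | ring].
- apply (is_derive_sum_n (fun j t => log_re y (t + INR j))); intros j _.
  now apply is_derive_shift, is_derive_log_re.
Qed.

Lemma is_derive_gauss_im (y x : R) (n : nat) : y <> 0 ->
  is_derive (gauss_im y n) x (dgauss_im y n x).
Proof.
intro Hy; unfold gauss_im, dgauss_im.
evar_last.
- apply (is_derive_minus (fun _ => y * ln (INR n))).
  + apply is_derive_const.
  + apply (is_derive_sum_n (fun j t => log_im y (t + INR j)) n x
             (fun j => - y / ((x + INR j) ^ 2 + y ^ 2))); intros j _.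
    now apply is_derive_shift, is_derive_log_im.
- exact (Rplus_0_l _).
Qed.

Lemma sum_Sn_R (a : nat -> R) (n : nat) : sum_n a (S n) = sum_n a n + a (S n).
Proof. exact (sum_Sn a n). Qed.

Lemma Rabs_div_le (a b c : R) : 0 < b -> Rabs a <= c * b -> Rabs (a / b) <= c.
Proof.
intros Hb H; unfold Rdiv; rewrite Rabs_mult, (Rabs_pos_eq (/ b)).
- apply (Rmult_le_reg_r b); [easy|].
  now rewrite Rmult_assoc, Rinv_l, Rmult_1_r by lra.
- left; now apply Rinv_0_lt_compat.
Qed.

(** With [z = x + i y], the real part of [log (z + N) - log N = log (1 + z / N)]
    agrees with that of [z / N] to second order in [1 / N]; the condition
    [6 * M <= N] keeps the [v] below in the range of [ln_1_add_approx]. The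
    constant [19] is only a common bound for this and the imaginary part. *)
Lemma log_re_far (M x y N : R) :
  Rabs x <= M -> Rabs y <= M -> 6 * M <= N -> 0 < N ->
  Rabs (x / N - (log_re y (x + N) - ln N)) <= 19 * M ^ 2 / N ^ 2.
Proof.
intros Hx Hy HM HN; apply Rabs_le_between in Hx; apply Rabs_le_between in Hy.
set (v := (2 * x * N + x ^ 2 + y ^ 2) / N ^ 2).
assert (Hxy : 0 <= x ^ 2 + y ^ 2 <= 2 * M ^ 2) by nra.
assert (Hv : Rabs v <= 3 * M / N).
{ unfold v; apply Rabs_div_le; [nra|].
  replace (3 * M / N * N ^ 2) with (3 * M * N) by (field; lra).
  apply Rabs_le; nra. }
assert (Hv2 : Rabs v <= / 2).
{ eapply Rle_trans; [apply Hv|].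
  apply (Rmult_le_reg_r (2 * N)); [lra|].
  replace (3 * M / N * (2 * N)) with (6 * M) by (field; lra); lra. }
assert (E : log_re y (x + N) - ln N = / 2 * ln (1 + v)).
{ unfold log_re.
  replace ((x + N) ^ 2 + y ^ 2) with (N ^ 2 * (1 + v))
    by (unfold v; field; lra).
  apply Rabs_le_between in Hv2.
  rewrite ln_mult by nra; rewrite ln_pow by lra; simpl; field. }
rewrite E.
replace (x / N - / 2 * ln (1 + v))
  with (- / 2 * (ln (1 + v) - v) + - ((x ^ 2 + y ^ 2) / (2 * N ^ 2)))
  by (unfold v; field; lra).
eapply Rle_trans; [apply Rabs_triang|].
rewrite Rabs_mult, !Rabs_Ropp, (Rabs_pos_eq (/ 2)) by lra.
pose proof (ln_1_add_approx v Hv2) as H1.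
assert (H2 : v ^ 2 <= 9 * M ^ 2 / N ^ 2).
{ rewrite <- (pow2_abs v).
  replace (9 * M ^ 2 / N ^ 2) with ((3 * M / N) ^ 2) by (field; lra).
  apply pow_incr; split; [apply Rabs_pos | easy]. }
assert (H3 : Rabs ((x ^ 2 + y ^ 2) / (2 * N ^ 2)) <= M ^ 2 / N ^ 2).
{ apply Rabs_div_le; [nra|].
  replace (M ^ 2 / N ^ 2 * (2 * N ^ 2)) with (2 * M ^ 2) by (field; lra).
  apply Rabs_le; lra. }
replace (19 * M ^ 2 / N ^ 2) with (9 * M ^ 2 / N ^ 2 + 9 * M ^ 2 / N ^ 2 + M ^ 2 / N ^ 2) by (field; lra).
assert (0 <= M ^ 2 / N ^ 2) by (apply Rdiv_le_0_compat; nra).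
lra.
Qed.

Lemma log_im_far (M x y N : R) : y <> 0 ->
  Rabs x <= M -> Rabs y <= M -> 6 * M <= N -> 0 < N ->
  Rabs (y / N - log_im y (x + N)) <= 19 * M ^ 2 / N ^ 2.
Proof.
intros Hy0 Hx Hy HM HN; apply Rabs_le_between in Hx.
assert (Hd : N / 2 <= x + N) by lra.
rewrite log_im_pos by (easy || lra).
set (w := y / (x + N)).
replace (y / N - atan w) with (y * x / (N * (x + N)) + - (atan w - w))
  by (unfold w; field; lra).
eapply Rle_trans; [apply Rabs_triang|]; rewrite Rabs_Ropp.
assert (HM0 : 0 <= M) by lra.
assert (H1 : Rabs (y * x / (N * (x + N))) <= 2 * M ^ 2 / N ^ 2).
{ apply Rabs_div_le; [nra|].
  rewrite Rabs_mult.
  apply (Rle_trans _ (M ^ 2)).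
  - replace (M ^ 2) with (M * M) by ring.
    apply Rmult_le_compat; try apply Rabs_pos; [easy | apply Rabs_le; lra].
  - replace (2 * M ^ 2 / N ^ 2 * (N * (x + N)))
      with (M ^ 2 * (2 * (x + N) / N)) by (field; lra).
    rewrite <- (Rmult_1_r (M ^ 2)) at 1.
    apply Rmult_le_compat_l; [nra|].
    apply (Rmult_le_reg_r N); [lra|].
    unfold Rdiv; rewrite Rmult_assoc, Rinv_l by lra; lra. }
assert (Hw : Rabs w <= 2 * M / N).
{ apply Rabs_div_le; [lra|].
  eapply Rle_trans; [apply Hy|].
  rewrite <- (Rmult_1_r M) at 1.
  replace (2 * M / N * (x + N)) with (M * (2 * (x + N) / N)) by (field; lra).
  apply Rmult_le_compat_l; [lra|].
  apply (Rmult_le_reg_r N); [lra|].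
  unfold Rdiv; rewrite Rmult_assoc, Rinv_l by lra; lra. }
assert (H2 : w ^ 2 <= 4 * M ^ 2 / N ^ 2).
{ rewrite <- (pow2_abs w).
  replace (4 * M ^ 2 / N ^ 2) with ((2 * M / N) ^ 2) by (field; lra).
  apply pow_incr; split; [apply Rabs_pos | easy]. }
pose proof (atan_approx w) as H3.
assert (0 <= M ^ 2 / N ^ 2) by (apply Rdiv_le_0_compat; nra).
replace (19 * M ^ 2 / N ^ 2) with (19 * (M ^ 2 / N ^ 2)) by (unfold Rdiv; ring).
replace (2 * M ^ 2 / N ^ 2) with (2 * (M ^ 2 / N ^ 2)) in H1 by (unfold Rdiv; ring).
replace (4 * M ^ 2 / N ^ 2) with (4 * (M ^ 2 / N ^ 2)) in H2 by (unfold Rdiv; ring).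
lra.
Qed.

Lemma inv_re_far (M x y N : R) :
  Rabs x <= M -> Rabs y <= M -> 6 * M <= N -> 0 < N ->
  Rabs (/ N - (x + N) / ((x + N) ^ 2 + y ^ 2)) <= 8 * M / N ^ 2.
Proof.
intros Hx Hy HM HN; apply Rabs_le_between in Hx; apply Rabs_le_between in Hy.
assert (HQ : N ^ 2 / 4 <= (x + N) ^ 2 + y ^ 2) by nra.
replace (/ N - (x + N) / ((x + N) ^ 2 + y ^ 2))
  with ((x * (x + N) + y ^ 2) / (N * ((x + N) ^ 2 + y ^ 2))) by (field; split; nra).
apply Rabs_div_le; [apply Rmult_lt_0_compat; nra|].
apply (Rle_trans _ (2 * M * N)); [apply Rabs_le; nra|].
replace (8 * M / N ^ 2 * (N * ((x + N) ^ 2 + y ^ 2)))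
  with (8 * M / N * ((x + N) ^ 2 + y ^ 2)) by (field; lra).
replace (2 * M * N) with (8 * M / N * (N ^ 2 / 4)) by (field; lra).
apply Rmult_le_compat_l; [apply Rdiv_le_0_compat; lra | easy].
Qed.

Lemma inv_im_far (M x y N : R) :
  Rabs x <= M -> Rabs y <= M -> 6 * M <= N -> 0 < N ->
  Rabs (- y / ((x + N) ^ 2 + y ^ 2)) <= 8 * M / N ^ 2.
Proof.
intros Hx Hy HM HN; apply Rabs_le_between in Hx.
assert (HQ : N ^ 2 / 4 <= (x + N) ^ 2 + y ^ 2) by nra.
apply Rabs_div_le; [nra|]; rewrite Rabs_Ropp.
apply (Rle_trans _ (2 * M)); [lra|].
replace (2 * M) with (8 * M / N ^ 2 * (N ^ 2 / 4)) by (field; lra).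
apply Rmult_le_compat_l; [apply Rdiv_le_0_compat; nra | easy].
Qed.

(** Common shape of the increments of a Gauss exponent and of its derivative:
    after adding and subtracting [t / (n + 1)], what remains is
    [t (ln (n + 1) - ln n - 1 / (n + 1))], of second order, plus an error [e]
    of second order. *)
Lemma increment_bound (n : nat) (t c d e : R) : (1 <= n)%nat ->
  Rabs t <= c -> Rabs e <= d / INR (S n) ^ 2 ->
  Rabs (t * (ln (INR (S n)) - ln (INR n) - / INR (S n)) + e) <=
  (c + d) / (INR n * INR (S n)).
Proof.
intros Hn Ht He; pose proof (ln_succ_approx n Hn) as Hl.
assert (Hn0 : 0 < INR n) by (apply lt_0_INR; lia).
eapply Rle_trans; [apply Rabs_triang|]; rewrite Rabs_mult.
unfold Rdiv; rewrite Rmult_plus_distr_r; apply Rplus_le_compat.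
- apply Rmult_le_compat; try apply Rabs_pos; easy.
- eapply Rle_trans; [apply He|].
  assert (HN : 0 < INR (S n)) by (apply lt_0_INR; lia).
  assert (Hd : 0 <= d).
  { apply (Rmult_le_reg_r (/ INR (S n) ^ 2)); [apply Rinv_0_lt_compat; nra|].
    rewrite Rmult_0_l; eapply Rle_trans; [apply (Rabs_pos e) | apply He]. }
  apply Rmult_le_compat_l; [easy|].
  apply Rinv_le_contravar; [nra|].
  rewrite S_INR in *; nra.
Qed.

(** The increment from [n] to [N = n + 1] of the Gauss exponent at [z] is
    [z (ln N - ln n - 1 / N) + (z / N - log (1 + z / N))], and that of its
    derivative is [(ln N - ln n - 1 / N) + (1 / N - 1 / (z + N))]. *)
Lemma gauss_increments (M x y : R) (n : nat) : y <> 0 ->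
  Rabs x <= M -> Rabs y <= M -> (1 <= n)%nat -> 6 * M <= INR n ->
  let c := M + 19 * M ^ 2 in
  let c' := 1 + 8 * M in
  Rabs (gauss_re y (S n) x - gauss_re y n x) <= c / (INR n * INR (S n)) /\
  Rabs (gauss_im y (S n) x - gauss_im y n x) <= c / (INR n * INR (S n)) /\
  Rabs (dgauss_re y (S n) x - dgauss_re y n x) <= c' / (INR n * INR (S n)) /\
  Rabs (dgauss_im y (S n) x - dgauss_im y n x) <= c' / (INR n * INR (S n)).
Proof.
intros Hy0 Hx Hy Hn HM c c'.
assert (HN : 0 < INR (S n)) by (apply lt_0_INR; lia).
assert (HMN : 6 * M <= INR (S n)) by (rewrite S_INR; lra).
unfold gauss_re, gauss_im, dgauss_re, dgauss_im; rewrite !sum_Sn_R.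
pose proof (INR_fact_lt_0 n).
set (N := INR (S n)) in *.
assert (Hf : ln (INR (fact (S n))) = ln N + ln (INR (fact n))).
{ change (fact (S n)) with (S n * fact n)%nat.
  rewrite mult_INR; now apply ln_mult. }
rewrite Hf.
assert (HQ : 0 < (x + N) ^ 2 + y ^ 2).
{ pose proof (pow2_ge_0 (x + N)); assert (0 < y ^ 2) by nra; lra. }
repeat split.
- eapply Rle_trans; [|apply (increment_bound n x M (19 * M ^ 2)
      (x / N - (log_re y (x + N) - ln N)) Hn Hx); now apply log_re_far].
  right; f_equal; fold N; field; lra.
- eapply Rle_trans; [|apply (increment_bound n y M (19 * M ^ 2)
      (y / N - log_im y (x + N)) Hn Hy); now apply log_im_far].
  right; f_equal; fold N; field; lra.
- eapply Rle_trans; [|apply (increment_bound n 1 1 (8 * M)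
      (/ N - (x + N) / ((x + N) ^ 2 + y ^ 2)) Hn);
      [rewrite Rabs_R1; lra | now apply inv_re_far]].
  right; f_equal; fold N; field; split; lra.
- eapply Rle_trans; [|apply (increment_bound n 0 1 (8 * M)
      (- (- y / ((x + N) ^ 2 + y ^ 2))) Hn);
      [rewrite Rabs_R0; lra | rewrite Rabs_Ropp; now apply inv_im_far]].
  right; f_equal; fold N; field; lra.
Qed.

(** Increments of order [1 / n^2], uniformly on bounded sets: the form in which
    the hypothesis of [seq_cv_rate] is available for the Gauss exponents and
    their derivatives alike. *)
Definition locally_telescoping (F : nat -> R -> R) : Prop :=
  forall M : R, 0 <= M -> exists (N : nat) (c : R), (1 <= N)%nat /\ 0 <= c /\
    forall (n : nat) (x : R), (N <= n)%nat -> Rabs x <= M ->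
      Rabs (F (S n) x - F n x) <= c / (INR n * INR (S n)).

Lemma telescoping_is_lim (F : nat -> R -> R) (x : R) :
  locally_telescoping F ->
  is_lim_seq (fun n => F n x) (real (Lim_seq (fun n => F n x))).
Proof.
intro HF; destruct (HF (Rabs x) (Rabs_pos x)) as [N [c [HN [Hc H]]]].
destruct (seq_cv_rate (fun n => F n x) c N HN Hc) as [l [Hl _]].
- intros n Hn; apply H; [easy | apply Rle_refl].
- now rewrite (is_lim_seq_unique _ _ Hl).
Qed.

Lemma telescoping_CVU (F : nat -> R -> R) (x0 : R) (r : posreal) :
  locally_telescoping F ->
  CVU F (fun x => real (Lim_seq (fun n => F n x))) x0 r.
Proof.
intros HF eps Heps; pose proof (cond_pos r) as Hr.
destruct (HF (Rabs x0 + r)) as [N [c [HN [Hc H]]]];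
  [pose proof (Rabs_pos x0); lra|].
destruct (nfloor_ex (Rmax 0 (c / eps)) (Rmax_l _ _)) as [K [_ HK]].
exists (N + S K)%nat; intros n x Hn Hx.
destruct (seq_cv_rate (fun n => F n x) c N HN Hc) as [l [Hl Hb]].
- intros m Hm; apply H; [easy|].
  unfold Boule in Hx.
  replace x with ((x - x0) + x0) by ring.
  eapply Rle_trans; [apply Rabs_triang | lra].
- rewrite (is_lim_seq_unique _ _ Hl); cbn [real].
  eapply Rle_lt_trans; [apply Hb; lia|].
  assert (Hn0 : c / eps < INR n).
  { apply (Rle_lt_trans _ _ _ (Rmax_r 0 _)), (Rlt_le_trans _ _ _ HK).
    rewrite <- S_INR; apply le_INR; lia. }
  assert (0 < INR n) by (apply lt_0_INR; lia).
  apply (Rmult_lt_compat_r eps) in Hn0; [|easy].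
  apply (Rmult_lt_reg_r (INR n)); [easy|].
  replace (c / INR n * INR n) with c by (field; lra).
  replace (c / eps * eps) with c in Hn0 by (field; lra); lra.
Qed.

(** Termwise differentiation: the derivatives converge uniformly near [x], and
    the functions themselves converge. *)
Lemma telescoping_is_derive (F dF : nat -> R -> R) (x : R) :
  locally_telescoping F -> locally_telescoping dF ->
  (forall n t, is_derive (F n) t (dF n t)) ->
  (forall n t, continuity_pt (dF n) t) ->
  is_derive (fun t => real (Lim_seq (fun n => F n t))) x
            (real (Lim_seq (fun n => dF n x))).
Proof.
intros HF HdF Hd Hc; apply is_derive_Reals.
set (r := mkposreal 1 Rlt_0_1).
apply (derivable_pt_lim_CVU F dF _ (fun t => real (Lim_seq (fun n => dF n t))) x x r).
- unfold Boule; rewrite Rminus_diag, Rabs_R0; apply (cond_pos r).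
- intros t n _; apply is_derive_Reals, Hd.
- intros t _; apply is_lim_seq_Reals; now apply (telescoping_is_lim F).
- now apply telescoping_CVU.
- apply (CVU_continuity dF _ x r); [now apply telescoping_CVU|].
  intros n t _; apply Hc.
Qed.

Lemma continuity_pt_sum_n (G : nat -> R -> R) (x : R) (n : nat) :
  (forall j, continuity_pt (G j) x) ->
  continuity_pt (fun t => sum_n (fun j => G j t) n) x.
Proof.
intro H; induction n as [|n IH].
- apply (continuity_pt_ext (G 0%nat)); [intro t; now rewrite sum_O | apply H].
- apply (continuity_pt_ext (fun t => sum_n (fun j => G j t) n + G (S n) t)).
  + intro t; now rewrite sum_Sn_R.
  + now apply (continuity_pt_plus (fun t => sum_n (fun j => G j t) n)).
Qed.

Lemma continuity_pt_dgauss_re (y : R) (n : nat) (x : R) : y <> 0 ->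
  continuity_pt (dgauss_re y n) x.
Proof.
intro Hy; unfold dgauss_re.
apply (continuity_pt_minus (fun _ => ln (INR n))).
- apply continuity_pt_const; now intros ? ?.
- apply (continuity_pt_sum_n (fun j x => (x + INR j) / ((x + INR j) ^ 2 + y ^ 2))).
  intro j; apply derivable_continuous_pt, ex_derive_Reals_0.
  assert (0 < y ^ 2) by nra; pose proof (pow2_ge_0 (x + INR j)).
  auto_derive; simpl in *; lra.
Qed.

Lemma continuity_pt_dgauss_im (y : R) (n : nat) (x : R) : y <> 0 ->
  continuity_pt (dgauss_im y n) x.
Proof.
intro Hy; unfold dgauss_im.
apply (continuity_pt_opp (fun x => sum_n (fun j => - y / ((x + INR j) ^ 2 + y ^ 2)) n)).
apply (continuity_pt_sum_n (fun j x => - y / ((x + INR j) ^ 2 + y ^ 2))).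
intro j; apply derivable_continuous_pt, ex_derive_Reals_0.
assert (0 < y ^ 2) by nra; pose proof (pow2_ge_0 (x + INR j)).
auto_derive; simpl in *; lra.
Qed.

Lemma gauss_telescoping (y : R) : y <> 0 ->
  locally_telescoping (gauss_re y) /\ locally_telescoping (gauss_im y) /\
  locally_telescoping (dgauss_re y) /\ locally_telescoping (dgauss_im y).
Proof.
intro Hy.
assert (H : forall M, 0 <= M -> exists N : nat, (1 <= N)%nat /\
  forall n x, (N <= n)%nat -> Rabs x <= M ->
    Rabs x <= Rmax M (Rabs y) /\ (1 <= n)%nat /\ 6 * Rmax M (Rabs y) <= INR n).
{ intros M HM; pose proof (Rmax_l M (Rabs y)).
  destruct (nfloor_ex (6 * Rmax M (Rabs y)) ltac:(lra)) as [K [_ HK]].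
  exists (S K); split; [lia|]; intros n x Hn Hx.
  repeat split; [lra | lia|].
  apply (Rle_trans _ (INR (S K))); [rewrite S_INR; lra | now apply le_INR]. }
assert (HM0 : forall M, 0 <= M -> 0 <= Rmax M (Rabs y))
  by (intros M HM; pose proof (Rmax_l M (Rabs y)); lra).
repeat split; intros M HM; destruct (H M HM) as [N [HN HNx]]; exists N;
  pose proof (HM0 M HM) as HM1;
  [ exists (Rmax M (Rabs y) + 19 * Rmax M (Rabs y) ^ 2)
  | exists (Rmax M (Rabs y) + 19 * Rmax M (Rabs y) ^ 2)
  | exists (1 + 8 * Rmax M (Rabs y))
  | exists (1 + 8 * Rmax M (Rabs y)) ];
  (split; [easy | split; [nra|]]); intros n x Hn Hx;
  destruct (HNx n x Hn Hx) as [H1 [H2 H3]];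
  destruct (gauss_increments _ x y n Hy H1 (Rmax_r _ _) H2 H3) as [? [? [? ?]]];
  assumption.
Qed.

(** Components of a logarithm of the Gamma function along the line [Im z = y]. *)
Definition lgamma_re (y x : R) : R := real (Lim_seq (fun n => gauss_re y n x)).
Definition lgamma_im (y x : R) : R := real (Lim_seq (fun n => gauss_im y n x)).

Lemma CLim_seq_Cexp (a b : nat -> R) (l m : R) :
  is_lim_seq a l -> is_lim_seq b m ->
  CLim_seq (fun n => Cexp (a n, b n)) = Cexp (l, m).
Proof.
intros Ha Hb; unfold CLim_seq.
assert (He : is_lim_seq (fun n => exp (a n)) (exp l)).
{ apply (is_lim_seq_continuous exp); [apply derivable_continuous, derivable_exp | easy]. }
assert (Hc : is_lim_seq (fun n => cos (b n)) (cos m)).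
{ apply (is_lim_seq_continuous cos); [apply derivable_continuous, derivable_cos | easy]. }
assert (Hs : is_lim_seq (fun n => sin (b n)) (sin m)).
{ apply (is_lim_seq_continuous sin); [apply derivable_continuous, derivable_sin | easy]. }
apply injective_projections; cbn [fst snd].
- rewrite (is_lim_seq_unique _ (exp l * cos m)).
  + simpl; ring.
  + eapply is_lim_seq_ext; [|apply (is_lim_seq_mult' _ _ _ _ He Hc)].
    intro n; simpl; ring.
- rewrite (is_lim_seq_unique _ (exp l * sin m)).
  + simpl; ring.
  + eapply is_lim_seq_ext; [|apply (is_lim_seq_mult' _ _ _ _ He Hs)].
    intro n; simpl; ring.
Qed.

Lemma CGamma_exp (x y : R) : y <> 0 ->
  CGamma (x, y) = Cexp (lgamma_re y x, lgamma_im y x).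
Proof.
intro Hy; destruct (gauss_telescoping y Hy) as [H1 [H2 _]].
rewrite <- (CLim_seq_Cexp (fun n => gauss_re y n x) (fun n => gauss_im y n x)).
- unfold CGamma, CLim_seq.
  f_equal; f_equal; apply Lim_seq_ext; intro n; now rewrite gauss_exp.
- now apply (telescoping_is_lim (gauss_re y)).
- now apply (telescoping_is_lim (gauss_im y)).
Qed.

Lemma is_lim_difference_quotient (F : R -> R) (x l : R) :
  is_derive F x l -> is_lim (fun t => (F t - F x) / (t - x)) x l.
Proof.
intro H; apply is_derive_Reals in H; apply is_lim_spec; intro eps.
destruct (H eps (cond_pos eps)) as [d Hd].
exists d; intros t Ht Hne.
replace t with (x + (t - x)) at 1 by ring.
apply Hd; [lra | exact Ht].
Qed.

(** [C_derive] takes its limit along the horizontal line through the point, so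
    it is given by two real derivatives. *)
Lemma C_derive_horizontal (f : C -> C) (x y a b : R) :
  is_derive (fun t => Re (f (t, y))) x a ->
  is_derive (fun t => Im (f (t, y))) x b ->
  C_derive f (x, y) = (a, b).
Proof.
intros Ha Hb; unfold C_derive, C_lim; cbn [fst snd].
assert (Hq : forall (w : C) (t : R), t <> x ->
  (w / ((t, y) - (x, y)))%C = (Re w / (t - x), Im w / (t - x))).
{ intros w t Ht.
  replace ((t, y) - (x, y))%C with (RtoC (t - x))
    by (apply injective_projections; simpl; ring).
  unfold Cdiv; rewrite <- RtoC_inv by lra.
  apply injective_projections; unfold Re, Im, Rdiv; simpl; ring. }
apply injective_projections; cbn [fst snd].
- rewrite (is_lim_unique _ _ a); [easy|].
  eapply is_lim_ext_loc; [|apply (is_lim_difference_quotient _ _ _ Ha)].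
  exists (mkposreal 1 Rlt_0_1); intros t _ Ht.
  rewrite Hq by exact Ht.
  reflexivity.
- rewrite (is_lim_unique _ _ b); [easy|].
  eapply is_lim_ext_loc; [|apply (is_lim_difference_quotient _ _ _ Hb)].
  exists (mkposreal 1 Rlt_0_1); intros t _ Ht.
  rewrite Hq by exact Ht.
  reflexivity.
Qed.

Lemma is_derive_lgamma_re (y x : R) : y <> 0 ->
  is_derive (lgamma_re y) x (real (Lim_seq (fun n => dgauss_re y n x))).
Proof.
intro Hy; destruct (gauss_telescoping y Hy) as [H1 [H2 [H3 H4]]].
apply (telescoping_is_derive (gauss_re y) (dgauss_re y)); auto.
- intros; now apply is_derive_gauss_re.
- intros; now apply continuity_pt_dgauss_re.
Qed.

Lemma is_derive_lgamma_im (y x : R) : y <> 0 ->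
  is_derive (lgamma_im y) x (real (Lim_seq (fun n => dgauss_im y n x))).
Proof.
intro Hy; destruct (gauss_telescoping y Hy) as [H1 [H2 [H3 H4]]].
apply (telescoping_is_derive (gauss_im y) (dgauss_im y)); auto.
- intros; now apply is_derive_gauss_im.
- intros; now apply continuity_pt_dgauss_im.
Qed.

(** Since [CGamma] is the exponential of [lgamma_re y + i lgamma_im y] on the line
    [Im z = y], its logarithmic derivative is the derivative of the exponent. *)
Lemma digamma_dgauss (x y : R) : y <> 0 ->
  digamma (x, y) = (real (Lim_seq (fun n => dgauss_re y n x)),
                    real (Lim_seq (fun n => dgauss_im y n x))).
Proof.
intro Hy; unfold digamma.
pose proof (is_derive_lgamma_re y x Hy) as HA.
pose proof (is_derive_lgamma_im y x Hy) as HB.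
set (a := real (Lim_seq (fun n => dgauss_re y n x))) in *.
set (b := real (Lim_seq (fun n => dgauss_im y n x))) in *.
assert (Ea : Derive (fun t : R => lgamma_re y t) x = a)
  by exact (is_derive_unique _ _ _ HA).
assert (Eb : Derive (fun t : R => lgamma_im y t) x = b)
  by exact (is_derive_unique _ _ _ HB).
rewrite (C_derive_horizontal CGamma x y
  (Re ((a, b) * Cexp (lgamma_re y x, lgamma_im y x))%C)
  (Im ((a, b) * Cexp (lgamma_re y x, lgamma_im y x))%C)).
- rewrite <- CGamma_exp by easy.
  unfold Re, Im; rewrite <- surjective_pairing.
  field; rewrite CGamma_exp by easy; apply Cexp_nz.
- apply (is_derive_ext (fun t => exp (lgamma_re y t) * cos (lgamma_im y t))).
  { intro t; rewrite CGamma_exp by easy; unfold Cexp, Re, Im, Cmult, RtoC; simpl; ring. }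
  auto_derive.
  + split; [now exists a | split; [now exists b | easy]].
  + rewrite Ea, Eb; simpl; ring.
- apply (is_derive_ext (fun t => exp (lgamma_re y t) * sin (lgamma_im y t))).
  { intro t; rewrite CGamma_exp by easy; unfold Cexp, Re, Im, Cmult, RtoC; simpl; ring. }
  auto_derive.
  + split; [now exists a | split; [now exists b | easy]].
  + rewrite Ea, Eb; simpl; ring.
Qed.

(** * Complex sums and limits *)

Notation Csum_n := (@sum_n C_AbelianMonoid).
Notation is_Cseries := (@is_series C_AbsRing C_NormedModule).
Notation Ccv u l := (filterlim u eventually (@locally C_UniformSpace l)).

Lemma Csum_O (a : nat -> C) : Csum_n a 0 = a 0%nat.
Proof. exact (sum_O a). Qed.

Lemma Csum_Sn (a : nat -> C) (n : nat) :
  Csum_n a (S n) = (Csum_n a n + a (S n))%C :> C.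
Proof. exact (sum_Sn a n). Qed.

Lemma Csum_mult_l (c : C) (a : nat -> C) (n : nat) :
  Csum_n (fun i => c * a i)%C n = (c * Csum_n a n)%C :> C.
Proof. exact (sum_n_mult_l (K := C_Ring) c a n). Qed.

Lemma Csum_plus (a b : nat -> C) (n : nat) :
  Csum_n (fun i => a i + b i)%C n = (Csum_n a n + Csum_n b n)%C :> C.
Proof. exact (sum_n_plus a b n). Qed.

Lemma Csum_zero (a : nat -> C) (n : nat) :
  (forall i, (i <= n)%nat -> a i = RtoC 0) -> Csum_n a n = RtoC 0 :> C.
Proof.
intro H; induction n as [|n IH].
- rewrite Csum_O; now apply H.
- rewrite Csum_Sn, IH, H by (intros; try apply H; lia); ring.
Qed.

Lemma Csum_components (a : nat -> C) (n : nat) :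
  Csum_n a n = (sum_n (fun i => Re (a i)) n, sum_n (fun i => Im (a i)) n).
Proof.
induction n as [|n IH].
- rewrite Csum_O, !sum_O; apply surjective_pairing.
- rewrite Csum_Sn, !sum_Sn_R, IH; apply injective_projections; reflexivity.
Qed.

Lemma Ccv_components (u : nat -> C) (l : C) :
  is_lim_seq (fun n => Re (u n)) (Re l) -> is_lim_seq (fun n => Im (u n)) (Im l) ->
  Ccv u l.
Proof.
intros H1 H2; apply filterlim_locally; intro eps.
generalize (filter_and _ _ (proj1 (filterlim_locally _ _) H1 eps)
                           (proj1 (filterlim_locally _ _) H2 eps)).
apply filter_imp; intros n [Ha Hb]; split; assumption.
Qed.

Lemma Ccv_plus (u v : nat -> C) (l m : C) :
  Ccv u l -> Ccv v m -> Ccv (fun n => u n + v n)%C (l + m)%C.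
Proof.
intros Hu Hv.
exact (filterlim_comp_2 _ _ _ Hu Hv (@filterlim_plus C_AbsRing C_NormedModule l m)).
Qed.

Lemma Ccv_mult_l (c : C) (u : nat -> C) (l : C) :
  Ccv u l -> Ccv (fun n => c * u n)%C (c * l)%C.
Proof.
intros Hu.
exact (filterlim_comp _ _ _ _ _ _ _ _ Hu (@filterlim_scal_r C_AbsRing C_NormedModule c l)).
Qed.

Lemma Ccv_sum (u : nat -> nat -> C) (l : nat -> C) (m : nat) :
  (forall i, (i <= m)%nat -> Ccv (u i) (l i)) ->
  Ccv (fun n => Csum_n (fun i => u i n) m) (Csum_n l m).
Proof.
intro H; induction m as [|m IH].
- rewrite Csum_O; apply (filterlim_ext (u 0%nat)); [|now apply H].
  intro n; now rewrite Csum_O.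
- rewrite Csum_Sn.
  apply (filterlim_ext (fun n => Csum_n (fun i => u i n) m + u (S m) n)%C).
  + intro n; now rewrite Csum_Sn.
  + apply Ccv_plus; [apply IH; intros; apply H; lia | now apply H].
Qed.

Lemma is_Cseries_unique (a : nat -> C) (l m : C) :
  is_Cseries a l -> is_Cseries a m -> l = m.
Proof.
exact (filterlim_locally_unique (K := C_AbsRing) (V := C_NormedModule) _ l m).
Qed.

Lemma is_Cseries_ext (a c : nat -> C) (l : C) :
  (forall n, a n = c n) -> is_Cseries a l -> is_Cseries c l.
Proof. exact (is_series_ext (K := C_AbsRing) (V := C_NormedModule) a c l). Qed.

Lemma is_Cseries_mult_l (c : C) (a : nat -> C) (l : C) :
  is_Cseries a l -> is_Cseries (fun n => c * a n)%C (c * l)%C.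
Proof. exact (is_series_scal_l (K := C_AbsRing) (V := C_NormedModule) c a l). Qed.

Lemma is_Cseries_plus (a c : nat -> C) (l m : C) :
  is_Cseries a l -> is_Cseries c m -> is_Cseries (fun n => a n + c n)%C (l + m)%C.
Proof. exact (is_series_plus (K := C_AbsRing) (V := C_NormedModule) a c l m). Qed.

Lemma ex_Cseries_le (a : nat -> C) (u : nat -> R) :
  (forall n, Cmod (a n) <= u n) -> ex_series u -> ex_Cseries a.
Proof.
exact (ex_series_le (K := C_AbsRing) (V := C_CompleteNormedModule) a u).
Qed.

Lemma Cseries_Cmod_le (a : nat -> C) (u : nat -> R) (l : C) (U : R) :
  (forall n, Cmod (a n) <= u n) -> is_Cseries a l -> is_series u U -> Cmod l <= U.
Proof.
exact (series_norm_le (K := C_AbsRing) (V := C_NormedModule) a u l U).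
Qed.

Lemma Cseries_fubini (a : nat -> nat -> C) (r c : nat -> C) (u v : nat -> R) :
  ex_series u -> ex_series v -> (forall i, 0 <= u i) ->
  (forall i j, Cmod (a i j) <= u i * v j) ->
  (forall i, is_Cseries (a i) (r i)) ->
  (forall j, is_Cseries (fun i => a i j) (c j)) ->
  exists S, is_Cseries r S /\ is_Cseries c S.
Proof.
exact (series_fubini (K := C_AbsRing) (V := C_CompleteNormedModule) a r c u v).
Qed.

Lemma digamma_lim (z : C) : Im z <> 0 ->
  Ccv (fun n => RtoC (ln (INR n)) -
                Csum_n (fun j => / (z + RtoC (INR j))) n)%C (digamma z).
Proof.
destruct z as [x y]; cbn [Im snd]; intro Hy.
destruct (gauss_telescoping y Hy) as [_ [_ [H3 H4]]].
assert (Hj : forall j, (/ ((x, y) + RtoC (INR j)))%C =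
  ((x + INR j) / ((x + INR j) ^ 2 + y ^ 2), - y / ((x + INR j) ^ 2 + y ^ 2))).
{ intro j; unfold Cinv; simpl; rewrite Rplus_0_r; reflexivity. }
apply (filterlim_ext (fun n => ((dgauss_re y n x, dgauss_im y n x) : C))).
{ intro n; rewrite (sum_n_ext _ _ n Hj), Csum_components.
  unfold dgauss_re, dgauss_im, Re, Im.
  apply injective_projections; simpl; ring. }
rewrite digamma_dgauss by easy.
apply Ccv_components.
- exact (telescoping_is_lim (dgauss_re y) x H3).
- exact (telescoping_is_lim (dgauss_im y) x H4).
Qed.

(** * The roots of -1 and the function b *)

Lemma Cexp_pow (z : C) (n : nat) : (Cexp z ^ n)%C = Cexp (RtoC (INR n) * z).
Proof.
induction n as [|n IH].
- simpl; rewrite Cmult_0_l; symmetry; apply Cexp_0.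
- rewrite Cpow_S, IH, <- Cexp_plus, S_INR, RtoC_plus; f_equal; ring.
Qed.

Lemma Cexp_Ci (t : R) : Cexp (RtoC t * Ci) = (cos t, sin t).
Proof.
unfold Cexp, Re, Im; simpl.
replace (t * 0 - 0 * 1) with 0 by ring; replace (t * 1 + 0 * 0) with t by ring.
rewrite exp_0; apply injective_projections; simpl; ring.
Qed.

Lemma eps_angle (k r : nat) : (1 <= k)%nat ->
  eps k r = Cexp (RtoC (PI / (2 * INR k) + INR r * (PI / INR k)) * Ci).
Proof.
intro Hk; unfold eps; f_equal.
assert (INR k <> 0) by (apply not_0_INR; lia).
rewrite RtoC_plus, RtoC_mult, !RtoC_div, RtoC_mult by lra; field.
repeat split; intro E; apply RtoC_inj in E; lra.
Qed.

Lemma eps_pow_2k (k r : nat) : (1 <= k)%nat -> (eps k r ^ (2 * k))%C = RtoC (-1).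
Proof.
intro Hk; rewrite eps_angle, Cexp_pow by easy.
assert (INR k <> 0) by (apply not_0_INR; lia).
rewrite Cmult_assoc, <- RtoC_mult, Cexp_Ci, mult_INR.
replace (INR 2 * INR k * (PI / (2 * INR k) + INR r * (PI / INR k)))
  with (PI + 2 * INR r * PI) by (simpl; field; easy).
rewrite cos_period, sin_period, cos_PI, sin_PI; reflexivity.
Qed.

(** A real number cannot have [(2 k)]-th power [-1]. *)
Lemma eps_Im_nz (k r : nat) : (1 <= k)%nat -> Im (eps k r) <> 0.
Proof.
intros Hk E; pose proof (eps_pow_2k k r Hk) as H.
replace (eps k r) with (RtoC (Re (eps k r))) in H
  by (apply injective_projections; [reflexivity | now symmetry]).
rewrite <- RtoC_pow, pow_mult in H; apply RtoC_inj in H.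
assert (0 <= (Re (eps k r) ^ 2) ^ k) by apply pow_le, pow2_ge_0; lra.
Qed.

Lemma geometric_Csum (q : C) (n : nat) :
  ((1 - q) * Csum_n (fun r => q ^ r) n)%C = (1 - q ^ S n)%C.
Proof.
induction n as [|n IH].
- rewrite Csum_O; simpl; ring.
- rewrite Csum_Sn, Cmult_plus_distr_l, IH, (Cpow_S q (S n)); ring.
Qed.

(** The [l]-th powers of the [eps k r] form a geometric progression with ratio
    [q = exp (i pi l / k)], where [q <> 1] but [q ^ (2 k) = 1]. *)
Lemma eps_power_sum (k l : nat) : (1 <= k)%nat -> (0 < l < 2 * k)%nat ->
  Csum_n (fun r => eps k r ^ l)%C (2 * k - 1) = RtoC 0 :> C.
Proof.
intros Hk Hl.
assert (Hk0 : 0 < INR k) by (apply lt_0_INR; lia).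
assert (Hl0 : 0 < INR l) by (apply lt_0_INR; lia).
assert (Hl1 : INR l < 2 * INR k).
{ replace 2 with (INR 2) by reflexivity; rewrite <- mult_INR; apply lt_INR; lia. }
set (q := Cexp (RtoC (INR l * (PI / INR k)) * Ci)).
assert (Hr : forall r, (eps k r ^ l)%C =
  (Cexp (RtoC (INR l * (PI / (2 * INR k))) * Ci) * q ^ r)%C).
{ intro r; unfold q; rewrite eps_angle, !Cexp_pow, <- Cexp_plus by easy.
  f_equal; rewrite !RtoC_mult, RtoC_plus, !RtoC_mult; ring. }
rewrite (sum_n_ext _ _ _ Hr), Csum_mult_l.
assert (Hq : (1 - q)%C <> 0).
{ unfold q; rewrite Cexp_Ci; intro E.
  apply (f_equal fst) in E; simpl in E.
  set (th := INR l * (PI / INR k)) in *.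
  assert (Hth : 0 < th / 2 < PI).
  { pose proof PI_RGT_0; unfold th; split.
    - assert (0 < INR l * (PI / INR k)); [|lra].
      apply Rmult_lt_0_compat; [easy | now apply Rdiv_lt_0_compat].
    - apply (Rmult_lt_reg_r (2 * INR k)); [lra|].
      replace (INR l * (PI / INR k) / 2 * (2 * INR k)) with (PI * INR l) by (field; lra).
      apply Rmult_lt_compat_l; lra. }
  pose proof (sin_gt_0 (th / 2) (proj1 Hth) (proj2 Hth)).
  replace th with (2 * (th / 2)) in E by field.
  rewrite cos_2a_sin in E; nra. }
assert (Hg : Csum_n (fun r => q ^ r)%C (2 * k - 1) = RtoC 0 :> C).
{ pose proof (geometric_Csum q (2 * k - 1)) as G.
  replace (S (2 * k - 1)) with (2 * k)%nat in G by lia.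
  assert (Hq1 : (q ^ (2 * k))%C = 1).
  { unfold q; rewrite Cexp_pow, Cmult_assoc, <- RtoC_mult, Cexp_Ci, mult_INR.
    replace (INR 2 * INR k * (INR l * (PI / INR k)))
      with (0 + 2 * INR l * PI) by (simpl; field; lra).
    rewrite cos_period, sin_period, cos_0, sin_0; reflexivity. }
  rewrite Hq1 in G.
  replace (Csum_n (fun r => q ^ r)%C (2 * k - 1))
    with (/ (1 - q) * ((1 - q) * Csum_n (fun r => q ^ r) (2 * k - 1)))%C
    by (field; exact Hq).
  rewrite G; ring. }
exact (eq_trans (f_equal (Cmult _) Hg) (Cmult_0_r _)).
Qed.

(** Homogeneous form of the geometric sum, so that the pole part [c = 0] of the
    digamma function is covered together with the other terms. *)
Lemma homogeneous_geometric_Csum (a c : C) (n : nat) :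
  ((a + c) * Csum_n (fun l => (- a) ^ l * c ^ (n - l)) n)%C =
  (c ^ S n - (- a) ^ S n)%C.
Proof.
induction n as [|n IH].
- rewrite Csum_O; simpl; ring.
- rewrite Csum_Sn.
  assert (E : Csum_n (fun l => (- a) ^ l * c ^ (S n - l))%C n =
              (c * Csum_n (fun l => (- a) ^ l * c ^ (n - l)) n)%C :> C).
  { rewrite <- Csum_mult_l; apply sum_n_ext_loc; intros l Hl.
    replace (S n - l)%nat with (S (n - l)) by lia.
    rewrite Cpow_S.
    change (@eq C ((- a) ^ l * (c * c ^ (n - l)))%C
                  (c * ((- a) ^ l * c ^ (n - l)))%C); ring. }
  rewrite E, Nat.sub_diag, Cmult_plus_distr_l.
  transitivity (c * ((a + c) * Csum_n (fun l => (- a) ^ l * c ^ (n - l)) n) +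
                (a + c) * (- a) ^ S n)%C; [simpl; ring|].
  rewrite IH, (Cpow_S c (S n)), (Cpow_S (- a)%C (S n)); ring.
Qed.

Lemma eps_affine_nz (k r : nat) (w t : R) : (1 <= k)%nat -> 0 < w ->
  (eps k r * RtoC w + RtoC t)%C <> 0.
Proof.
intros Hk Hw E; apply (f_equal Im) in E.
unfold Cplus, Cmult, RtoC, Im in E; cbn [fst snd] in E.
apply (eps_Im_nz k r Hk); unfold Im.
apply (Rmult_eq_reg_r w); lra.
Qed.

(** Because [(eps w) ^ (2 k) = - w ^ (2 k)], each [1 / (eps w + t)] is a polynomial
    in [eps] of degree [2 k - 1] divided by [t ^ (2 k) + w ^ (2 k)]. After
    multiplication by [eps ^ 2] the exponents run over [2, ..., 2 k + 1], and the
    sum over the roots kills every power except [eps ^ (2 k)]. *)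
Lemma eps_partial_fractions (k : nat) (w t : R) : (2 <= k)%nat -> 0 < w -> 0 <= t ->
  Csum_n (fun r => eps k r ^ 2 * / (eps k r * RtoC w + RtoC t))%C (2 * k - 1) =
  RtoC (- (2 * INR k * (w ^ (2 * k - 2) * t / (t ^ (2 * k) + w ^ (2 * k))))) :> C.
Proof.
intros Hk Hw Ht.
assert (HQ : 0 < t ^ (2 * k) + w ^ (2 * k)).
{ pose proof (pow_lt w (2 * k) Hw); pose proof (pow_le t (2 * k) Ht); lra. }
set (Q := t ^ (2 * k) + w ^ (2 * k)) in *.
assert (HQC : RtoC Q <> 0) by (intro E; apply RtoC_inj in E; lra).
set (coef := fun l => (/ RtoC Q * ((- RtoC w) ^ l * RtoC t ^ (2 * k - 1 - l)))%C).
assert (Hterm : forall r, (eps k r ^ 2 * / (eps k r * RtoC w + RtoC t))%C =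
  Csum_n (fun l => coef l * eps k r ^ (l + 2))%C (2 * k - 1)).
{ intro r; pose proof (eps_affine_nz k r w t ltac:(lia) Hw) as Hnz.
  pose proof (homogeneous_geometric_Csum (eps k r * RtoC w) (RtoC t) (2 * k - 1)) as G.
  replace (S (2 * k - 1)) with (2 * k)%nat in G by lia.
  replace (- (eps k r * RtoC w))%C with (eps k r * - RtoC w)%C in G by ring.
  assert (Hp : (RtoC t ^ (2 * k) - (eps k r * - RtoC w) ^ (2 * k))%C = RtoC Q).
  { rewrite Cpow_mult_l, eps_pow_2k by lia.
    rewrite <- RtoC_opp, <- !RtoC_pow, <- RtoC_mult, <- RtoC_minus; f_equal.
    rewrite !(pow_mult _ 2 k).
    replace ((- w) ^ 2) with (w ^ 2) by ring.
    unfold Q; rewrite !(pow_mult _ 2 k); ring. }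
  rewrite Hp in G.
  assert (E : Csum_n (fun l => coef l * eps k r ^ (l + 2))%C (2 * k - 1) =
    (/ RtoC Q * eps k r ^ 2 * Csum_n (fun l => (eps k r * - RtoC w) ^ l *
        RtoC t ^ (2 * k - 1 - l)) (2 * k - 1))%C :> C).
  { rewrite <- Csum_mult_l; apply sum_n_ext; intro l; unfold coef.
    rewrite Cpow_mult_l, Cpow_add_r.
    match goal with |- ?a = ?b => change (@eq C a b) end; ring. }
  match goal with |- ?a = ?b => change (@eq C a b) end.
  rewrite E.
  set (S := Csum_n _ _) in *.
  transitivity (/ RtoC Q * eps k r ^ 2 * (/ (eps k r * RtoC w + RtoC t) *
                  ((eps k r * RtoC w + RtoC t) * S)))%C.
  - rewrite G; field; now split.
  - field; now split. }
rewrite (sum_n_ext _ _ _ Hterm), sum_n_switch.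
assert (Hcol : forall l, Csum_n (fun r => coef l * eps k r ^ (l + 2))%C (2 * k - 1) =
   (coef l * Csum_n (fun r => eps k r ^ (l + 2)) (2 * k - 1))%C :> C)
  by (intro l; apply Csum_mult_l).
rewrite (sum_n_ext _ _ _ Hcol).
(* isolate the two top exponents 2k and 2k + 1; the power sums below them vanish *)
replace (2 * k - 1)%nat with (S (S (2 * k - 3))) at 1 by lia.
rewrite !Csum_Sn, Csum_zero.
2:{ intros l Hl; rewrite eps_power_sum by lia; ring. }
replace (S (2 * k - 3)) with (2 * k - 2)%nat by lia.
replace (S (2 * k - 2)) with (2 * k - 1)%nat by lia.
replace (2 * k - 2 + 2)%nat with (2 * k)%nat by lia.
assert (H1 : Csum_n (fun r => eps k r ^ (2 * k))%C (2 * k - 1) = RtoC (- (2 * INR k)) :> C).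
{ rewrite (sum_n_ext _ (fun _ => RtoC (-1))) by (intro r; apply eps_pow_2k; lia).
  rewrite Csum_components; unfold Re, Im; cbn [fst snd RtoC].
  rewrite !sum_n_const; apply injective_projections; cbn [fst snd RtoC].
  - replace (S (2 * k - 1)) with (2 * k)%nat by lia.
    rewrite mult_INR; simpl; ring.
  - ring. }
assert (H2 : Csum_n (fun r => eps k r ^ (2 * k - 1 + 2))%C (2 * k - 1) = RtoC 0 :> C).
{ replace (2 * k - 1 + 2)%nat with (2 * k + 1)%nat by lia.
  rewrite (sum_n_ext _ (fun r => RtoC (-1) * eps k r ^ 1)%C).
  - rewrite Csum_mult_l, eps_power_sum by lia; ring.
  - intro r; rewrite Cpow_add_r, eps_pow_2k by lia; reflexivity. }
rewrite H1, H2; unfold coef.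
replace (2 * k - 1 - (2 * k - 2))%nat with 1%nat by lia.
rewrite <- RtoC_opp, <- !RtoC_pow, <- RtoC_inv by lra.
replace ((- w) ^ (2 * k - 2)) with (w ^ (2 * k - 2)).
2:{ replace (2 * k - 2)%nat with (2 * (k - 1))%nat by lia.
    rewrite !pow_mult; f_equal; ring. }
rewrite Cmult_0_r, Cplus_0_r, Cplus_0_l, <- !RtoC_mult; f_equal.
field; lra.
Qed.

(** The terms [ln n] of the digamma limits cancel as the squares [eps ^ 2] sum to
    zero, which is where [k >= 2] enters; each remaining term is evaluated by
    partial fractions. *)
Lemma b_series (k : nat) (w : R) : (2 <= k)%nat -> 0 < w ->
  is_Cseries
    (fun j => RtoC (2 * (w ^ (2 * k - 2) * INR j / (INR j ^ (2 * k) + w ^ (2 * k)))))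
    (b k w).
Proof.
intros Hk Hw.
assert (Hk0 : RtoC (INR k) <> 0)
  by (intro E; apply RtoC_inj in E; revert E; apply not_0_INR; lia).
assert (Hlim : Ccv (fun n => / RtoC (INR k) * Csum_n (fun r =>
    eps k r ^ 2 * (RtoC (ln (INR n)) -
      Csum_n (fun j => / (eps k r * RtoC w + RtoC (INR j))) n)) (2 * k - 1))%C (b k w)).
{ apply Ccv_mult_l, (Ccv_sum (fun r n => eps k r ^ 2 * (RtoC (ln (INR n)) -
      Csum_n (fun j => / (eps k r * RtoC w + RtoC (INR j))) n))%C); intros r _.
  apply Ccv_mult_l, digamma_lim.
  replace (Im (eps k r * RtoC w)) with (Im (eps k r) * w)
    by (unfold Im, Cmult, RtoC; cbn [fst snd]; ring).
  apply Rmult_integral_contrapositive; split; [apply eps_Im_nz; lia | lra]. }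
refine (filterlim_ext _ _ _ Hlim); intro n.
assert (E : forall r, (eps k r ^ 2 * (RtoC (ln (INR n)) -
      Csum_n (fun j => / (eps k r * RtoC w + RtoC (INR j))) n))%C =
   (RtoC (ln (INR n)) * eps k r ^ 2 + RtoC (-1) *
     Csum_n (fun j => eps k r ^ 2 * / (eps k r * RtoC w + RtoC (INR j))) n)%C).
{ intro r; rewrite Csum_mult_l; ring. }
rewrite (sum_n_ext _ _ _ E), Csum_plus, !Csum_mult_l, eps_power_sum by lia.
rewrite sum_n_switch.
rewrite (sum_n_ext _ _ n (fun j => eps_partial_fractions k w (INR j) Hk Hw (pos_INR j))).
rewrite (sum_n_ext _ (fun j => RtoC (- INR k) *
  RtoC (2 * (w ^ (2 * k - 2) * INR j / (INR j ^ (2 * k) + w ^ (2 * k)))))%C n).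
2:{ intro j; rewrite <- RtoC_mult; f_equal; ring. }
rewrite Csum_mult_l.
set (S := Csum_n _ n).
change (/ RtoC (INR k) * (RtoC (ln (INR n)) * RtoC 0 +
          RtoC (-1) * (RtoC (- INR k) * S)) = S)%C.
replace (RtoC (-1)) with (- RtoC 1)%C by (rewrite <- RtoC_opp; reflexivity).
rewrite RtoC_opp; field; exact Hk0.
Qed.

(** * Dirichlet series *)

Lemma Cmod_Cexp (z : C) : Cmod (Cexp z) = exp (Re z).
Proof.
unfold Cexp; rewrite Cmod_mult, Cmod_R, Rabs_pos_eq by (left; apply exp_pos).
unfold Cmod; cbn [fst snd].
replace (cos (Im z) ^ 2 + sin (Im z) ^ 2) with 1.
- rewrite sqrt_1; ring.
- pose proof (sin2_cos2 (Im z)) as H; unfold Rsqr in H; simpl; lra.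
Qed.

Lemma Cmod_nat_Cpow (n : nat) (z : C) : Cmod (nat_Cpow n z) = Rpower (INR n) (Re z).
Proof.
unfold nat_Cpow; rewrite Cmod_Cexp; unfold Rpower; f_equal.
unfold Re, Cmult, RtoC; simpl; ring.
Qed.

Lemma nat_Cpow_INR (n s : nat) : (1 <= n)%nat ->
  nat_Cpow n (RtoC (INR s)) = RtoC (INR n ^ s).
Proof.
intro Hn; unfold nat_Cpow.
assert (0 < INR n) by (apply lt_0_INR; lia).
rewrite <- Rpower_pow, <- RtoC_mult by easy; unfold Rpower, Cexp, Re, Im, RtoC.
cbn [fst snd]; rewrite cos_0, sin_0; apply injective_projections; simpl; ring.
Qed.

Lemma poly_bounded_nonneg (h : nat -> C) (alpha : R) : poly_bounded h alpha ->
  exists K : R, 0 <= K /\ forall n : nat, (1 <= n)%nat ->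
    Cmod (h n) <= K * Rpower (INR n) alpha.
Proof.
intros [K HK]; exists K; split; [|exact HK].
pose proof (HK 1%nat (le_n _)) as H1.
pose proof (Cmod_ge_0 (h 1%nat)).
assert (0 < Rpower (INR 1) alpha) by apply exp_pos; nra.
Qed.

Lemma ex_dirichlet_series (f : nat -> C) (alpha : R) (z : C) :
  poly_bounded f alpha -> 1 + alpha < Re z ->
  ex_Cseries (fun i => dirichlet_term f z (S i)).
Proof.
intros Hf Hz; destruct (poly_bounded_nonneg f alpha Hf) as [K [HK Hb]].
apply (ex_Cseries_le _ (fun i => K * Rpower (INR (S i)) (- (Re z - alpha)))).
- intro i; unfold dirichlet_term.
  assert (Hp : 0 < Rpower (INR (S i)) (Re z)) by apply exp_pos.
  rewrite Cmod_div, Cmod_nat_Cpow.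
  + replace (- (Re z - alpha)) with (alpha + - Re z) by ring.
    rewrite Rpower_plus, Rpower_Ropp, <- Rmult_assoc.
    apply Rmult_le_compat_r; [left; now apply Rinv_0_lt_compat|].
    apply Hb; lia.
  + intro E; pose proof (Cmod_nat_Cpow (S i) z) as E'.
    rewrite E, Cmod_0 in E'; lra.
- apply (ex_series_scal_l (K := R_AbsRing) (V := R_NormedModule)), ex_series_Rpower; lra.
Qed.

(** * Multiples and divisors *)

Lemma div_mod_succ (N m : nat) : (1 <= m)%nat ->
  (if S N mod m =? 0 then S N / m = S (N / m) /\ S N = S (N / m) * m
   else S N / m = N / m)%nat.
Proof.
intro Hm.
pose proof (Nat.div_mod_eq N m) as E; pose proof (Nat.mod_upper_bound N m ltac:(lia)) as B.
generalize dependent (N / m)%nat; generalize dependent (N mod m)%nat; intros r B q E.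
destruct (Nat.eq_dec (S r) m) as [Hr|Hr].
- rewrite <- (Nat.mod_unique (S N) m (S q) 0) by lia.
  rewrite <- (Nat.div_unique (S N) m (S q) 0) by lia.
  simpl; lia.
- rewrite <- (Nat.mod_unique (S N) m q (S r)) by lia.
  now rewrite <- (Nat.div_unique (S N) m q (S r)) by lia.
Qed.

(** Up to [N] the multiples of [m] are [j * m] with [j <= N / m]: the partial sums
    of one series are those of the other at the index [N / m]. *)
Lemma is_Cseries_multiples (phi : nat -> C) (m : nat) (l : C) :
  (1 <= m)%nat -> phi 0%nat = RtoC 0 ->
  is_Cseries (fun j => phi (j * m)%nat) l ->
  is_Cseries (fun i => if (S i mod m =? 0)%nat then phi (S i) else RtoC 0) l.
Proof.
intros Hm H0 Hl.
set (a := fun N => if (N mod m =? 0)%nat then phi N else RtoC 0).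
assert (Ha0 : a 0%nat = RtoC 0) by (unfold a; now destruct (0 mod m =? 0)%nat).
apply (is_series_incr_1 (K := C_AbsRing) (V := C_NormedModule) a).
rewrite Ha0; change (plus l (RtoC 0)) with (l + RtoC 0)%C; rewrite Cplus_0_r.
assert (Hsum : forall N, Csum_n (fun j => phi (j * m)%nat) (N / m)%nat = Csum_n a N :> C).
{ induction N as [|N IH].
  - rewrite Nat.Div0.div_0_l, !Csum_O, Ha0; exact H0.
  - rewrite (Csum_Sn a), <- IH; unfold a.
    generalize (div_mod_succ N m Hm).
    destruct (S N mod m =? 0)%nat.
    + intros [E1 E2]; rewrite E1, Csum_Sn, <- E2; reflexivity.
    + intros ->; now rewrite Cplus_0_r. }
apply (filterlim_ext (fun N => Csum_n (fun j => phi (j * m)%nat) (N / m)%nat)); [exact Hsum|].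
refine (filterlim_comp _ _ _ _ _ _ _ _ _ Hl).
intros P [n0 Hn0]; exists (n0 * m)%nat; intros n Hn; apply Hn0.
apply Nat.div_le_lower_bound; lia.
Qed.

Lemma is_Cseries_divisor_sum (g : nat -> C) (n : nat) : (1 <= n)%nat ->
  is_Cseries (fun i => if (n mod S i =? 0)%nat then g (S i) else RtoC 0)
    (divisor_sum g n).
Proof.
intro Hn.
set (c := fun d => if (n mod d =? 0)%nat then g d else RtoC 0).
assert (Hc : forall d, (n < d)%nat -> c d = RtoC 0).
{ intros d Hd; unfold c; rewrite Nat.mod_small by easy.
  destruct (Nat.eqb_spec n 0); [lia | easy]. }
assert (Hs : forall N, Csum_n (fun i => c (S i)) N = sum_n_m c 1 (S N)).
{ intro N; unfold sum_n; now rewrite (sum_n_m_S c). }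
assert (Hst : forall N, (n <= S N)%nat -> Csum_n (fun i => c (S i)) N = divisor_sum g n).
{ intros N HN; rewrite Hs; unfold divisor_sum; fold c.
  induction HN as [|N' HN IH]; [reflexivity|].
  rewrite sum_n_Sm by lia; rewrite IH, Hc by lia.
  exact (Cplus_0_r _). }
apply (filterlim_ext_loc (fun _ => divisor_sum g n)).
- exists n; intros N HN; symmetry; apply Hst; lia.
- apply filterlim_const.
Qed.

(** * The triple series *)

(** [kern k N n] is the coefficient left on a multiple [N] of [m] when
    [b k (n / m)] is written as a series over the multiples of [m]; [weight]
    attaches to it the Dirichlet coefficient [f n / n ^ (2 k - 1)]. *)
Definition kern (k N n : nat) : R := 2 * INR N / (INR N ^ (2 * k) + INR n ^ (2 * k)).

Definition weight (f : nat -> C) (k N n : nat) : C :=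
  (f n * RtoC (kern k N n / INR n ^ (2 * k - 1)))%C.

(** Put [w = n / m] in the series for [b k w] and [N = j m]: the powers of [m] are
    absorbed, and [m] survives only in the condition that it divides [N]. *)
Lemma inner_term_series (f : nat -> C) (k m n : nat) :
  (2 <= k)%nat -> (1 <= m)%nat -> (1 <= n)%nat ->
  is_Cseries
    (fun i => if (S i mod m =? 0)%nat then weight f k (S i) n else RtoC 0)
    (/ RtoC (INR m) * inner_term f k m n)%C.
Proof.
intros Hk Hm Hn.
assert (Hm0 : 0 < INR m) by (apply lt_0_INR; lia).
assert (Hn0 : 0 < INR n) by (apply lt_0_INR; lia).
apply (is_Cseries_multiples (fun N => weight f k N n)); [easy| |].
{ unfold weight, kern; simpl INR.
  replace (2 * 0 / _ / _) with 0 by (unfold Rdiv; ring); ring. }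
unfold inner_term.
replace (/ RtoC (INR m) * (f n / RtoC (INR n) ^ (4 * k - 3) * b k (INR n / INR m)))%C
  with ((f n * RtoC (/ INR m * / INR n ^ (4 * k - 3))) * b k (INR n / INR m))%C.
2:{ rewrite RtoC_mult, RtoC_inv, RtoC_inv, RtoC_pow by (try apply pow_nonzero; lra).
    unfold Cdiv; ring. }
eapply is_Cseries_ext;
  [|apply is_Cseries_mult_l, (b_series k (INR n / INR m) Hk); now apply Rdiv_lt_0_compat].
intro j; cbv beta; unfold weight.
rewrite <- Cmult_assoc, <- RtoC_mult; f_equal; f_equal; unfold kern.
rewrite mult_INR; unfold Rdiv; rewrite !Rpow_mult_distr, !pow_inv.
replace (4 * k - 3)%nat with ((2 * k - 2) + (2 * k - 1))%nat by lia.
replace (2 * k)%nat with ((2 * k - 2) + 2)%nat by lia.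
replace (2 * k - 2 + 2 - 2)%nat with (2 * k - 2)%nat by lia.
replace (2 * k - 2 + 2 - 1)%nat with (2 * k - 1)%nat by lia.
rewrite !pow_add.
assert (Hp : forall x e, 0 < x -> 0 < x ^ e) by (intros; now apply pow_lt).
pose proof (Hp _ (2 * k - 2)%nat Hm0); pose proof (Hp _ (2 * k - 2)%nat Hn0).
pose proof (Hp _ (2 * k - 1)%nat Hn0).
pose proof (pow_le (INR j) (2 * k - 2) (pos_INR j)).
set (me := INR m ^ (2 * k - 2)) in *; set (ne := INR n ^ (2 * k - 2)) in *.
set (ns := INR n ^ (2 * k - 1)) in *; set (je := INR j ^ (2 * k - 2)) in *.
pose proof (pow2_ge_0 (INR j)).
assert (0 < ne * INR n ^ 2) by (apply Rmult_lt_0_compat; [easy | now apply pow_lt]).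
assert (0 <= je * INR j ^ 2 * (me * INR m ^ 2)).
{ apply Rmult_le_pos; [nra|]; apply Rmult_le_pos; [lra | apply pow2_ge_0]. }
field; repeat split; try lra.
Qed.

Lemma Rpower_m3 (n : nat) : (1 <= n)%nat -> Rpower (INR n) (-3) = / INR n ^ 3.
Proof.
intro Hn; replace (-3) with (- (3)) by ring.
rewrite Rpower_Ropp, <- Rpower_pow by (apply lt_0_INR; lia).
do 2 f_equal; simpl; ring.
Qed.

Lemma inv_pow_le_m3 (n s : nat) : (1 <= n)%nat -> (3 <= s)%nat ->
  / INR n ^ s <= Rpower (INR n) (-3).
Proof.
intros Hn Hs; rewrite Rpower_m3 by easy.
apply Rinv_le_contravar; [apply pow_lt, lt_0_INR; lia|].
apply Rle_pow; [apply (le_INR 1); lia | easy].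
Qed.

Lemma kern_bounds (k N n : nat) : (2 <= k)%nat -> (1 <= N)%nat -> (1 <= n)%nat ->
  0 <= kern k N n <= 2 * Rpower (INR N) (-3).
Proof.
intros Hk HN Hn; unfold kern.
assert (HN0 : 0 < INR N) by (apply lt_0_INR; lia).
assert (Hn0 : 0 < INR n) by (apply lt_0_INR; lia).
pose proof (pow_lt _ (2 * k) HN0); pose proof (pow_lt _ (2 * k) Hn0).
split; [apply Rdiv_le_0_compat; lra|].
unfold Rdiv; rewrite Rmult_assoc; apply Rmult_le_compat_l; [lra|].
eapply Rle_trans; [|apply (inv_pow_le_m3 N (2 * k - 1)); lia].
apply (Rle_trans _ (INR N * / INR N ^ (2 * k))).
- apply Rmult_le_compat_l; [lra|]; apply Rinv_le_contravar; lra.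
- replace (2 * k)%nat with (S (2 * k - 1)) at 1 by lia.
  simpl pow; right; field; split; [apply pow_nonzero|]; lra.
Qed.

Lemma weight_bound (f : nat -> C) (alpha F : R) (k N n : nat) :
  (forall n, (1 <= n)%nat -> Cmod (f n) <= F * Rpower (INR n) alpha) ->
  0 <= F -> (2 <= k)%nat -> (1 <= N)%nat -> (1 <= n)%nat ->
  Cmod (weight f k N n) <=
    2 * F * Rpower (INR n) (- (3 - alpha)) * Rpower (INR N) (-3).
Proof.
intros Hf HF Hk HN Hn; unfold weight.
destruct (kern_bounds k N n Hk HN Hn) as [K0 K1].
assert (Hn0 : 0 < INR n ^ (2 * k - 1)) by (apply pow_lt, lt_0_INR; lia).
rewrite Cmod_mult, Cmod_R, Rabs_pos_eq by (apply Rdiv_le_0_compat; lra).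
pose proof (inv_pow_le_m3 n (2 * k - 1) Hn ltac:(lia)) as Hs.
replace (- (3 - alpha)) with (alpha + -3) by ring; rewrite Rpower_plus.
replace (2 * F * (Rpower (INR n) alpha * Rpower (INR n) (-3)) * Rpower (INR N) (-3))
  with ((F * Rpower (INR n) alpha) *
        (2 * Rpower (INR N) (-3) * Rpower (INR n) (-3))) by ring.
apply Rmult_le_compat; [apply Cmod_ge_0 | apply Rdiv_le_0_compat; lra | now apply Hf |].
apply Rmult_le_compat; try lra; left; now apply Rinv_0_lt_compat.
Qed.

(** With [p = (3 - alpha) / 2 > 1] one has [3 - p = alpha + p], and [m <= N] moves
    the factor [N ^ - (3 - p)] to [m ^ - (3 - p)]. Divisibility of [N] by [m]
    enters the estimates only through [m <= N], and the bound is a product of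
    terms of convergent series. *)
Lemma divisor_power_bound (alpha : R) (m N : nat) :
  0 < alpha < 1 -> (1 <= m)%nat -> (m <= N)%nat ->
  Rpower (INR m) alpha * Rpower (INR N) (-3) <=
  Rpower (INR m) (- ((3 - alpha) / 2)) * Rpower (INR N) (- ((3 - alpha) / 2)).
Proof.
intros Ha Hm HmN.
assert (Hm1 : 0 < INR m) by (apply lt_0_INR; lia).
assert (HN1 : INR m <= INR N) by (apply le_INR; lia).
set (p := (3 - alpha) / 2).
replace alpha with (- p + (3 - p)) at 1 by (unfold p; field).
replace (-3) with (- (3 - p) + - p) by ring.
rewrite !Rpower_plus, Rmult_assoc, <- (Rmult_assoc (Rpower (INR m) (3 - p))).
apply Rmult_le_compat_l; [left; apply exp_pos|].
rewrite <- (Rmult_1_l (Rpower (INR N) (- p))) at 2.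
apply Rmult_le_compat_r; [left; apply exp_pos|].
rewrite Rpower_Ropp.
assert (Hpos : 0 < Rpower (INR N) (3 - p)) by apply exp_pos.
apply (Rmult_le_reg_r (Rpower (INR N) (3 - p))); [easy|].
rewrite Rmult_assoc, Rinv_l, Rmult_1_r, Rmult_1_l by lra.
apply Rle_Rpower_l; [unfold p; lra | easy].
Qed.

Lemma kern_symmetrised (k N n : nat) : (1 <= k)%nat -> (1 <= N)%nat -> (1 <= n)%nat ->
  kern k N n / INR n ^ (2 * k - 1) + kern k n N / INR N ^ (2 * k - 1) =
  2 * / INR n ^ (2 * k - 1) * / INR N ^ (2 * k - 1).
Proof.
intros Hk HN Hn; unfold kern.
assert (HN0 : 0 < INR N) by (apply lt_0_INR; lia).
assert (Hn0 : 0 < INR n) by (apply lt_0_INR; lia).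
replace (2 * k)%nat with (S (2 * k - 1)) by lia.
replace (S (2 * k - 1) - 1)%nat with (2 * k - 1)%nat by lia.
pose proof (pow_lt _ (2 * k - 1) HN0); pose proof (pow_lt _ (2 * k - 1) Hn0).
rewrite <- !tech_pow_Rmult.
assert (0 < INR N * INR N ^ (2 * k - 1)) by now apply Rmult_lt_0_compat.
assert (0 < INR n * INR n ^ (2 * k - 1)) by now apply Rmult_lt_0_compat.
field; repeat split; lra.
Qed.

Lemma dirichlet_term_nat (f : nat -> C) (s n : nat) : (1 <= n)%nat ->
  dirichlet_term f (RtoC (INR s)) n = (f n * RtoC (/ INR n ^ s))%C.
Proof.
intro Hn; unfold dirichlet_term; rewrite nat_Cpow_INR by easy.
rewrite RtoC_inv; [easy | apply pow_nonzero, not_0_INR; lia].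
Qed.

Lemma weighted_pair_sum (f : nat -> C) (k : nat) :
  (1 <= k)%nat -> forall i j,
  (f (S j) * weight f k (S j) (S i) + f (S i) * weight f k (S i) (S j))%C =
  (RtoC 2 * dirichlet_term f (RtoC (INR (2 * k - 1))) (S i) *
            dirichlet_term f (RtoC (INR (2 * k - 1))) (S j))%C.
Proof.
intros Hk i j; rewrite !dirichlet_term_nat by lia; unfold weight.
transitivity (f (S i) * f (S j) *
  RtoC (kern k (S j) (S i) / INR (S i) ^ (2 * k - 1) +
        kern k (S i) (S j) / INR (S j) ^ (2 * k - 1)))%C.
- rewrite RtoC_plus; ring.
- rewrite kern_symmetrised, !RtoC_mult by lia; ring.
Qed.

(** Interchanging the two summations exchanges the roles of [n] and [N]. Adding the
    two forms, the kernels combine to [2 / (n N) ^ (2 k - 1)], so twice the sum is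
    twice the square of the Dirichlet series. *)
Lemma symmetric_double_series (f : nat -> C) (k : nat) (u : nat -> R) (B : R)
  (c : nat -> C) (T : C) :
  (1 <= k)%nat -> ex_series u -> (forall i, 0 <= u i) ->
  (forall i j, Cmod (f (S j) * weight f k (S j) (S i))%C
               <= u i * (B * u j)) ->
  (forall i, is_Cseries
     (fun j => f (S j) * weight f k (S j) (S i))%C (c i)) ->
  is_Cseries c T ->
  ex_Cseries (fun i => dirichlet_term f (RtoC (INR (2 * k - 1))) (S i)) ->
  T = (L f (RtoC (INR (2 * k - 1))) ^ 2)%C.
Proof.
intros Hk Hu u0 Hb Hc HT HL.
set (a := fun i j => (f (S j) * weight f k (S j) (S i))%C) in *.
set (D := fun i => dirichlet_term f (RtoC (INR (2 * k - 1))) (S i)) in *.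
assert (HLs : is_Cseries D (L f (RtoC (INR (2 * k - 1))))) by exact (CSeries_correct D HL).
set (Lf := L f (RtoC (INR (2 * k - 1)))) in *.
assert (Hcol : forall j, ex_Cseries (fun i => a i j)).
{ intro j; apply (ex_Cseries_le _ (fun i => u i * (B * u j))).
  - intro i; apply Hb.
  - now apply ex_series_scal_r. }
assert (Hcol' : forall j, is_Cseries (fun i => a i j) (CSeries (fun i => a i j)))
  by (intro j; now apply CSeries_correct).
destruct (Cseries_fubini a c (fun j => CSeries (fun i => a i j)) u (fun j => B * u j))
  as [T' [HT1 HT2]]; try assumption.
{ now apply (ex_series_scal_l (K := R_AbsRing) (V := R_NormedModule)). }
rewrite <- (is_Cseries_unique _ _ _ HT HT1) in HT2.
assert (Hsum : is_Cseries (fun i => c i + CSeries (fun j => a j i))%C (T + T)%C)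
  by now apply is_Cseries_plus.
assert (Hdouble : forall i, (c i + CSeries (fun j => a j i))%C = (RtoC 2 * Lf * D i)%C).
{ intro i.
  apply (is_Cseries_unique (fun j => a i j + a j i)%C).
  - apply is_Cseries_plus; [apply Hc | apply Hcol'].
  - apply (is_Cseries_ext (fun j => RtoC 2 * D i * D j)%C).
    + intro j; symmetry; now apply weighted_pair_sum.
    + replace (RtoC 2 * Lf * D i)%C with (RtoC 2 * D i * Lf)%C by ring.
      now apply is_Cseries_mult_l. }
pose proof (is_Cseries_unique _ _ _ (is_Cseries_ext _ _ _ Hdouble Hsum)
              (is_Cseries_mult_l (RtoC 2 * Lf)%C D Lf HLs)) as E.
replace T with (/ RtoC 2 * (T + T))%C by field.
rewrite E; simpl; field.
Qed.

Lemma if_mult_l (e : bool) (x y : C) :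
  (x * (if e then y else RtoC 0))%C = (if e then x * y else RtoC 0)%C.
Proof. destruct e; ring. Qed.

Theorem theorem5 (g f : nat -> C) (alpha : R)
  (Hf : forall n : nat, (1 <= n)%nat -> f n = divisor_sum g n)
  (Halpha : (0 < alpha < 1)%R)
  (Hfb : poly_bounded f alpha) (Hgb : poly_bounded g alpha) :
  (forall z : C, (1 + alpha < Re z)%R ->
     ex_Cseries (fun i => dirichlet_term f z (S i))) /\
  (forall k : nat, (2 <= k)%nat ->
     (forall m : nat, (1 <= m)%nat ->
        ex_Cseries (fun i => inner_term f k m (S i))) /\
     ex_Cseries (fun j => outer_term f g k (S j)) /\
     (L f (RtoC (INR (2 * k - 1))) ^ 2)%C =
       CSeries (fun j => outer_term f g k (S j))).
Proof.
assert (HL : forall z : C, (1 + alpha < Re z)%R ->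
               ex_Cseries (fun i => dirichlet_term f z (S i)))
  by (intros z Hz; now apply (ex_dirichlet_series f alpha)).
split; [exact HL|]; intros k Hk.
destruct (poly_bounded_nonneg f alpha Hfb) as [F [HF HfF]].
destruct (poly_bounded_nonneg g alpha Hgb) as [G [HG HgG]].
(* the exponent with 3 - alpha = 2 p, so that both f n / n ^ 3 and the terms
   bounded by divisor_power_bound are dominated by summable powers *)
set (p := (3 - alpha) / 2).
set (u := fun i => Rpower (INR (S i)) (- p)).
assert (Hu : ex_series u) by (apply ex_series_Rpower; unfold p; lra).
assert (u0 : forall i, 0 <= u i) by (intro i; left; apply exp_pos).
assert (HcU : forall c, ex_series (fun i => c * u i))
  by (intro c; now apply (ex_series_scal_l (K := R_AbsRing) (V := R_NormedModule))).
set (w := fun i j => weight f k (S j) (S i)).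
assert (Hw : forall i j, Cmod (w i j) <= 2 * F * u i * Rpower (INR (S j)) (-3)).
{ intros i j; unfold w.
  eapply Rle_trans; [apply (weight_bound f alpha F); easy || lia|].
  apply Rmult_le_compat_r; [left; apply exp_pos|].
  apply Rmult_le_compat_l; [lra|].
  apply Rle_Rpower; [apply (le_INR 1); lia | unfold p; lra]. }
assert (Hwg : forall (h : nat -> C) (H : R), 0 <= H ->
   (forall n, (1 <= n)%nat -> Cmod (h n) <= H * Rpower (INR n) alpha) ->
   forall m i j, (1 <= m)%nat -> (m <= S j)%nat ->
   Cmod (h m * w i j)%C <= 2 * F * H * u i * (Rpower (INR m) (- p) * u j)).
{ intros h H HH Hh m i j Hm Hmj; rewrite Cmod_mult.
  apply (Rle_trans _ ((H * Rpower (INR m) alpha) *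
                      (2 * F * u i * Rpower (INR (S j)) (-3)))).
  - apply Rmult_le_compat; try apply Cmod_ge_0; [now apply Hh | apply Hw].
  - pose proof (divisor_power_bound alpha m (S j) Halpha Hm Hmj) as Hd.
    fold p in Hd; change (Rpower (INR (S j)) (- p)) with (u j) in Hd.
    replace (H * Rpower (INR m) alpha * (2 * F * u i * Rpower (INR (S j)) (-3)))
      with (2 * F * H * u i * (Rpower (INR m) alpha * Rpower (INR (S j)) (-3))) by ring.
    apply Rmult_le_compat_l; [|exact Hd].
    repeat apply Rmult_le_pos; try lra; apply u0. }
(* t m i j is the general term of the triple series at the indices m + 1, n = i + 1
   and N = j + 1; its sum over N is row m i, and the sum of row m i over n is an
   outer term *)
set (t := fun m i j => if (S j mod S m =? 0)%nat then (g (S m) * w i j)%C else RtoC 0).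
assert (Ht : forall m i j, Cmod (t m i j) <= 2 * F * G * u i * (u m * u j)).
{ intros m i j; unfold t.
  destruct (Nat.eqb_spec (S j mod S m) 0) as [E|E].
  - apply Hwg; try easy; [lia|].
    destruct (Nat.le_gt_cases (S m) (S j)) as [Hle|Hlt]; [easy|].
    rewrite Nat.mod_small in E; lia.
  - rewrite Cmod_0; repeat apply Rmult_le_pos; try lra; apply u0. }
assert (Hinner : forall m, (1 <= m)%nat -> ex_Cseries (fun i => inner_term f k m (S i))).
{ intros m Hm; destruct Hu as [U HU].
  assert (Hm0 : RtoC (INR m) <> 0)
    by (intro E; apply RtoC_inj in E; revert E; apply not_0_INR; lia).
  apply (ex_Cseries_le _ (fun i => (INR m * (2 * F * U)) * u i)); [|apply HcU].
  intro i.
  replace (inner_term f k m (S i))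
    with (RtoC (INR m) * (/ RtoC (INR m) * inner_term f k m (S i)))%C by (field; exact Hm0).
  rewrite Cmod_mult, Cmod_R, Rabs_pos_eq, !(Rmult_assoc (INR m)) by apply pos_INR.
  apply Rmult_le_compat_l; [apply pos_INR|].
  replace (2 * F * U * u i) with (2 * F * u i * U) by ring.
  apply (Cseries_Cmod_le _ (fun j => 2 * F * u i * u j) _ _
           ) with (2 := inner_term_series f k m (S i) Hk Hm ltac:(lia)).
  - intro j; destruct (S j mod m =? 0)%nat.
    + eapply Rle_trans; [apply Hw|].
      apply Rmult_le_compat_l; [repeat apply Rmult_le_pos; try lra; apply u0|].
      apply Rle_Rpower; [apply (le_INR 1); lia | unfold p; lra].
    + rewrite Cmod_0; repeat apply Rmult_le_pos; try lra; apply u0.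
  - exact (is_series_scal_l (K := R_AbsRing) (V := R_NormedModule) (2 * F * u i) u U HU). }
split; [exact Hinner|].
set (row := fun m i => (g (S m) * (/ RtoC (INR (S m)) * inner_term f k (S m) (S i)))%C).
assert (Hrow : forall m i, is_Cseries (t m i) (row m i)).
{ intros m i; unfold t, row.
  eapply is_Cseries_ext; [|apply is_Cseries_mult_l, inner_term_series; easy || lia].
  intro j; cbv beta; now rewrite if_mult_l. }
assert (Houter : forall m, is_Cseries (row m) (outer_term f g k (S m))).
{ intro m; unfold row, outer_term.
  eapply is_Cseries_ext;
    [|apply is_Cseries_mult_l, CSeries_correct, Hinner; lia].
  intro i; cbv beta; unfold Cdiv; ring. }
(* summing t over m first turns the divisor sum of g into f *)
set (a := fun i j => (f (S j) * w i j)%C).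
assert (Ha : forall i j, Cmod (a i j) <= u i * (2 * F * F * u j)).
{ intros i j; unfold a.
  eapply Rle_trans; [apply (Hwg f F HF HfF); lia|].
  change (Rpower (INR (S j)) (- p)) with (u j).
  assert (Hu1 : u j <= 1).
  { unfold u; rewrite <- (Rpower_O (INR (S j))) by (apply lt_0_INR; lia).
    apply Rle_Rpower; [apply (le_INR 1); lia | unfold p; lra]. }
  replace (2 * F * F * u i * (u j * u j)) with (u i * (2 * F * F * u j) * u j) by ring.
  rewrite <- (Rmult_1_r (u i * (2 * F * F * u j))) at 2.
  apply Rmult_le_compat_l; [|easy].
  repeat apply Rmult_le_pos; try lra; apply u0. }
assert (Hac : forall i, is_Cseries (a i) (CSeries (a i))).
{ intro i; apply CSeries_correct.
  apply (ex_Cseries_le _ (fun j => u i * (2 * F * F * u j))); [apply Ha|].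
  apply (ex_series_scal_l (K := R_AbsRing) (V := R_NormedModule) (u i)
           (fun j => 2 * F * F * u j)), HcU. }
assert (Hta : forall i j, is_Cseries (fun m => t m i j) (a i j)).
{ intros i j; unfold a; rewrite Hf by lia.
  rewrite Cmult_comm.
  eapply is_Cseries_ext;
    [|apply is_Cseries_mult_l, (is_Cseries_divisor_sum g (S j)); lia].
  intro m; cbv beta; unfold t; rewrite if_mult_l.
  destruct (_ =? _)%nat; [apply Cmult_comm | easy]. }
assert (Hcol : forall i, is_Cseries (fun m => row m i) (CSeries (a i))).
{ intro i.
  destruct (Cseries_fubini (fun m j => t m i j) (fun m => row m i) (a i)
              u (fun j => 2 * F * G * u i * u j) Hu (HcU _) u0) as [T [HT1 HT2]].
  - intros m j; eapply Rle_trans; [apply Ht|]; right; ring.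
  - intro m; apply Hrow.
  - apply Hta.
  - now rewrite (is_Cseries_unique _ _ _ (Hac i) HT2). }
assert (HR : exists B, forall m i, Cmod (row m i) <= u m * (B * u i)).
{ destruct Hu as [U HU]; exists (2 * F * G * U); intros m i.
  replace (u m * (2 * F * G * U * u i)) with (2 * F * G * u i * u m * U) by ring.
  apply (Cseries_Cmod_le (t m i) (fun j => 2 * F * G * u i * u m * u j)).
  - intro j; eapply Rle_trans; [apply Ht|]; right; ring.
  - apply Hrow.
  - exact (is_series_scal_l (K := R_AbsRing) (V := R_NormedModule)
             (2 * F * G * u i * u m) u U HU). }
destruct HR as [B HB].
destruct (Cseries_fubini row (fun m => outer_term f g k (S m)) (fun i => CSeries (a i))
            u (fun i => B * u i) Hu (HcU B) u0 HB Houter Hcol) as [T [HT1 HT2]].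
assert (Hex : ex_Cseries (fun j => outer_term f g k (S j))) by now exists T.
split; [exact Hex|].
rewrite <- (is_Cseries_unique _ _ _ HT1 (CSeries_correct _ Hex)).
symmetry; apply (symmetric_double_series f k u (2 * F * F) (fun i => CSeries (a i)));
  try easy; [lia|].
apply HL; unfold Re, RtoC; cbn [fst].
apply (Rlt_le_trans _ (INR 3)); [simpl; lra | apply le_INR; lia].
Qed.
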